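(* Let $s\ge1$ and $n=2^{s-1}$. If $B_1,B_2\in\mathbf{S}$, then the $n\times n$ matrix-valued function $(z,w)\mapsto B_1(z)B_2(w)$ on $\mathbb{T}^2$ is $(s+1)$-attainable.
   Context: $\mathbb{T}$ is the unit circle with uniform probability measure; functions are identified if equal a.e. $\mathbf{S}$ is the set of measurable functions $B$ from $\mathbb{T}$ to the complex $n\times n$ matrices of operator norm $<1$ with $\int_{\mathbb{T}}\log\det(\mathrm{Id}-BB^* )>-\infty$. $\mathcal{G}_0$ ($\mathcal{G}_1$) denotes the upper (lower) triangular complex matrices with positive diagonal entries. For $\alpha:\{0,1\}\to\{0,1\}$ and $m\ge1$, $SU_\alpha(2m)$ is the set of matrices $\begin{pmatrix} E & F \\ G & H \end{pmatrix}\in SU(2m)$ with $m\times m$ blocks such that $E\in\mathcal{G}_{\alpha(0)}$ and $H\in\mathcal{G}_{\alpha(1)}$. Let $z,w\in\mathbb{T}$ be two variables, and fix a measurable branch of the square root on $\mathbb{T}$. The QSP protocols on $r$ qubits ($r\ge1$), which are $2^r\times2^r$ matrix functions of $(z,w)$, are defined inductively by: - for every $\alpha:\{0,1\}\to\{0,1\}$, all (constant) matrices in $SU_\alpha(2^r)$ are QSP protocols on $r$ qubits; - the $2^r\times2^r$ matrices $\begin{pmatrix} z^{1/2}\mathrm{Id} & 0 \\ 0 & z^{-1/2}\mathrm{Id} \end{pmatrix}$ and $\begin{pmatrix} w^{1/2}\mathrm{Id} & 0 \\ 0 & w^{-1/2}\mathrm{Id} \end{pmatrix}$ (blocks of size $2^{r-1}$)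 and their inverses are QSP protocols on $r$ qubits; - if $M$ is a QSP protocol on $r$ qubits, then tensoring $M$ with the $2\times2$ identity matrix gives a QSP protocol on $r+1$ qubits. Here the identity may be inserted at any of the $r+1$ tensor positions of $(\mathbb{C}^2)^{\otimes(r+1)}$; that is, the new qubit on which the identity acts may be placed anywhere. A matrix function $B(z,w)$ with values in $k\times k$ matrices, with $k=2^q\le2^{r-1}$, is called $r$-attainable if it is the top right $k\times k$ corner block of a $2^r\times2^r$ matrix function which is a finite product of QSP protocols on $r$ qubits, or a limit in $L^2(\mathbb{T}^2)$ of such finite products. *)

(* Defs.v *)
(* MathComp / MathComp-Analysis, over an arbitrary realType R; the complex
   numbers are R[i]. *)
From HB Require Import structures.
From mathcomp Require Import all_boot all_order all_algebra.
From mathcomp Require Import all_classical all_reals all_analysis.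
From mathcomp Require Import measurable_realfun.
From mathcomp Require Import complex.

Set Implicit Arguments.
Unset Strict Implicit.
Unset Printing Implicit Defensive.

Import Order.TTheory GRing.Theory Num.Theory.
Import numFieldNormedType.Exports.
Import ComplexField Normc.

Local Open Scope classical_set_scope.
Local Open Scope ring_scope.
Local Open Scope complex_scope.
Local Open Scope sesquilinear_scope.

Record circle (R : realType) := Circle {
  circle_val :> R[i];
  circle_valP : `|circle_val| == 1 }.

HB.instance Definition _ (R : realType) := [isSub for @circle_val R].
HB.instance Definition _ (R : realType) := [Choice of circle R by <:].

Fact circle1_subproof (R : realType) : `|1 : R[i]| == 1.
Proof. by rewrite normr1. Qed.

HB.instance Definition _ (R : realType) :=
  isPointed.Build (circle R) (Circle (circle1_subproof R)).

Definition circle_coord (R : realType) (z : circle R) :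
  (measurableTypeR R * measurableTypeR R)%type :=
  (complex.Re (z : R[i]), complex.Im (z : R[i])).

(* The Borel sigma-algebra of the circle, as the trace of that of the plane. *)
HB.instance Definition _ (R : realType) :=
  Measurable.copy (circle R) (g_sigma_algebra_preimageType (@circle_coord R)).

Fact circle_exp_subproof (R : realType) (t : R) :
  `|cos (2 * pi * t) +i* sin (2 * pi * t)| == 1.
Proof. by rewrite normc_def /= cos2Dsin2 sqrtr1. Qed.

Definition circle_exp (R : realType) (t : measurableTypeR R) : circle R :=
  Circle (circle_exp_subproof (t : R)).

Fact measurable_circle_exp (R : realType) :
  measurable_fun setT (@circle_exp R).
Proof.
move=> _ _ [B mB <-]; rewrite !setTI.
have mlin : measurable_fun setT (fun t : R => 2 * pi * t).
  exact: mulrl_measurable.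
have mf : measurable_fun setT
    (fun t : measurableTypeR R => circle_coord (circle_exp t)).
  apply: measurable_fun_pair => /=; apply: measurableT_comp => //.
    by apply: continuous_measurable_fun; exact: continuous_cos.
  by apply: continuous_measurable_fun; exact: continuous_sin.
by rewrite -[X in measurable X]setTI; exact: (mf measurableT B mB).
Qed.

HB.instance Definition _ (R : realType) :=
  isMeasurableFun.Build _ _ _ _ (@circle_exp R) (@measurable_circle_exp R).

Definition circle_prob (R : realType) : probability (circle R) R :=
  distribution (uniform_prob (@ltr01 R)) (@circle_exp R).

Definition torus_prob (R : realType) :
    probability (circle R * circle R)%type R :=
  (circle_prob R \x circle_prob R)%E.

Definition measurable_cfun (R : realType) d (T : measurableType d)
    (f : T -> R[i]) : Prop :=
  measurable_fun setT (fun x => complex.Re (f x)) /\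
  measurable_fun setT (fun x => complex.Im (f x)).

Definition measurable_mxfun (R : realType) d (T : measurableType d) m n
    (F : T -> 'M[R[i]]_(m, n)) : Prop :=
  forall i j, measurable_cfun (fun x => F x i j).

(* Euclidean (Frobenius) norm; on 'cV_n, the usual norm of C^n. *)
Definition mxnorm2 (R : realType) m n (A : 'M[R[i]]_(m, n)) : R :=
  Num.sqrt (\sum_i \sum_j normc (A i j) ^+ 2).

Definition opnorm (R : realType) n (A : 'M[R[i]]_n) : R :=
  sup [set mxnorm2 (A *m v) | v in [set v : 'cV[R[i]]_n | mxnorm2 v <= 1]].

(* The determinant below is a positive real number wherever opnorm (B z) < 1,
   so that taking its real part only changes its type. *)
Definition classS (R : realType) n (B : circle R -> 'M[R[i]]_n) : Prop :=
  [/\ measurable_mxfun B,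
      {ae circle_prob R, forall z, opnorm (B z) < 1} &
      (-oo < \int[circle_prob R]_z
               (ln (complex.Re (\det (1%:M - B z *m (B z)^t* ))))%:E)%E].

(* false stands for 0 (upper triangular), true for 1 (lower triangular);
   0 < x in R[i] means that x is real and positive. *)
Definition triangular_pos (R : realType) m (b : bool) (A : 'M[R[i]]_m) : bool :=
  is_trig_mx (if b then A else A^T) && [forall i, 0 < A i i].

Definition SU_alpha (R : realType) m (alpha : bool -> bool) :
    pred 'M[R[i]]_(m + m) :=
  fun U => [&& U \is unitarymx, \det U == 1,
               triangular_pos (alpha false) (ulsubmx U) &
               triangular_pos (alpha true) (drsubmx U)].

Fact addnn_expn2 r : (2 ^ r + 2 ^ r = 2 ^ r.+1)%N.
Proof. by rewrite expnS mul2n addnn. Qed.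

Definition qubit_mx (R : realType) r (A : 'M[R[i]]_(2 ^ r + 2 ^ r)) :
    'M[R[i]]_(2 ^ r.+1) :=
  castmx (addnn_expn2 r, addnn_expn2 r) A.

Definition phase_mx (R : realType) r (c : R[i]) : 'M[R[i]]_(2 ^ r.+1) :=
  qubit_mx (block_mx c%:M 0 0 (c^-1)%:M).

(* The index i < 2 ^ r encodes a basis vector of the r-fold tensor power of C^2
   by its binary digits. The position j of a qubit is counted from the least
   significant digit, i.e. from the last tensor factor. *)
Definition digit (j i : nat) : bool := odd (i %/ 2 ^ j).

Definition del_digit (j i : nat) : nat :=
  (i %/ 2 ^ j.+1 * 2 ^ j + i %% 2 ^ j)%N.

Fact del_digit_subproof r (j : 'I_r.+1) (i : 'I_(2 ^ r.+1)) :
  (del_digit j i < 2 ^ r)%N.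
Proof.
case: j i => [j /= jr] [i /= ir]; rewrite /del_digit.
have q_lt : (i %/ 2 ^ j.+1 < 2 ^ (r - j))%N.
  by rewrite ltn_divLR ?expn_gt0// -expnD addnS subnK.
have r_lt : (i %% 2 ^ j < 2 ^ j)%N by rewrite ltn_mod expn_gt0.
apply: (@leq_trans ((i %/ 2 ^ j.+1).+1 * 2 ^ j)).
  by rewrite mulSn addnC ltn_add2r.
by rewrite -[in leqRHS](subnK (jr : (j <= r)%N)) expnD leq_mul2r q_lt orbT.
Qed.

Definition del_qubit r (j : 'I_r.+1) (i : 'I_(2 ^ r.+1)) : 'I_(2 ^ r) :=
  Ordinal (del_digit_subproof j i).

(* M acting on r of the r.+1 qubits, and the identity on the qubit j. *)
Definition tens_id (R : realType) r (j : 'I_r.+1) (M : 'M[R[i]]_(2 ^ r)) :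
    'M[R[i]]_(2 ^ r.+1) :=
  \matrix_(a, b) if digit j a == digit j b
                 then M (del_qubit j a) (del_qubit j b) else 0.

Inductive QSP (R : realType) (sq : circle R -> R[i]) :
    forall r, (circle R * circle R -> 'M[R[i]]_(2 ^ r)) -> Prop :=
| QSP_const r (alpha : bool -> bool) (U : 'M[R[i]]_(2 ^ r + 2 ^ r)) :
    U \in SU_alpha alpha -> QSP sq (fun=> qubit_mx U)
| QSP_z r : QSP sq (fun zw => phase_mx r (sq zw.1))
| QSP_w r : QSP sq (fun zw => phase_mx r (sq zw.2))
| QSP_zV r : QSP sq (fun zw => invmx (phase_mx r (sq zw.1)))
| QSP_wV r : QSP sq (fun zw => invmx (phase_mx r (sq zw.2)))
| QSP_tens r (j : 'I_r.+1) M : QSP sq M -> QSP sq (fun zw => tens_id j (M zw)).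

Definition QSP_product (R : realType) (sq : circle R -> R[i]) r
    (Q : circle R * circle R -> 'M[R[i]]_(2 ^ r)) : Prop :=
  exists l (P : 'I_l -> circle R * circle R -> 'M[R[i]]_(2 ^ r)),
    (forall i, QSP sq (P i)) /\ forall zw, Q zw = \prod_(i < l) P i zw.

Definition L2_limit (R : realType) m n
    (F : nat -> circle R * circle R -> 'M[R[i]]_(m, n))
    (G : circle R * circle R -> 'M[R[i]]_(m, n)) : Prop :=
  measurable_mxfun G /\
  ('N[torus_prob R]_2%:E [(fun zw => (mxnorm2 (F l zw - G zw))%:E)])%E
    @[l --> \oo] --> 0%E.

Definition topright (R : realType) k N (kN : (k <= N)%N) (M : 'M[R[i]]_N) :
    'M[R[i]]_k :=
  ursubmx (castmx (esym (subnKC kN), esym (subnK kN)) M).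

(* The square root is a parameter: sq z stands for z^{1/2}. *)
Definition attainable (R : realType) (sq : circle R -> R[i]) r k
    (B : circle R * circle R -> 'M[R[i]]_k) : Prop :=
  [/\ (1 <= r)%N, exists q, k = (2 ^ q)%N, (k <= 2 ^ r.-1)%N &
    exists (kN : (k <= 2 ^ r)%N)
           (Q : circle R * circle R -> 'M[R[i]]_(2 ^ r)),
      (QSP_product sq Q \/
       exists F, (forall l, QSP_product sq (F l)) /\ L2_limit F Q) /\
      {ae torus_prob R, forall zw, B zw = topright kN (Q zw)}].

(* Main.v *)
Require Import Defs.
From mathcomp Require Import all_boot all_order all_algebra.
From mathcomp Require Import all_classical all_reals all_analysis.
From mathcomp Require Import measurable_realfun complex ring lra.

(* Uniform limits of QSP products behave like a Lie group. Call X tangent when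
   the products contain g_t = 1 + t X + o(t), uniformly on the torus. Tangent
   functions form a real Lie algebra stable under conjugation by products, and
   exp X is a uniform limit of products for the tangent X considered below. The
   rotations of SU_alpha in the plane of two basis vectors from different
   halves, conjugated by the phases and commuted with each other, make f X
   tangent for every skew-Hermitian traceless constant X and every real
   polynomial f in the coordinates of z and w. Since exp (f X) depends only on
   the values of f, these polynomials may be replaced, in measure, by arbitrary
   indicator functions, hence every measurable SU(2^(s+1))-valued function on
   the torus is a limit of products. It remains to find such a function whose
   top right block is B1(z) B2(w): this product is a strict contraction almost
   everywhere, and it is dilated with the square root of 1 - B^* B. *)

Set Implicit Arguments.
Unset Strict Implicit.
Unset Printing Implicit Defensive.

Import Order.TTheory GRing.Theory Num.Theory.
Import numFieldNormedType.Exports.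
Import ComplexField Normc.
Local Open Scope classical_set_scope.
Local Open Scope ring_scope.
Local Open Scope complex_scope.
Local Open Scope sesquilinear_scope.

(** * The sum of the absolute values of the entries of a complex matrix *)

(** The commutator of the generators of two rotations, in the planes (a, b) and (b, c), generates a
    rotation in the plane (a, c) whose coefficient is the product of theirs. With a third index at
    hand, the functions that may multiply rotations thus form an algebra; z and w belong to it
    because conjugation by a phase multiplies a coefficient between the two halves by the square of
    the chosen root. The obstacle is that tangency is a uniform notion, whereas the target is merely
    measurable. The passage to the limit is therefore made after exponentiation: the exponential is
    Lipschitz in its real exponent, so exponents may converge in measure only, and the boundedness
    of unitary matrices turns convergence in measure into convergence in L2. The dilation must have
    size 2^(s+1) = 4 n exactly. The column with blocks B, sqrt (1 - B^* B), 0 is an isometry V into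
    dimension 3 n, and the matrix with blocks 1 - V V^*, V, V^*, 0 completes it to a unitary by a
    formula, hence measurably. *)

Section ComplexMatrixNorm.
Context {R : realType}.
Implicit Types (x y : R[i]).

Lemma normr_normc x : `|x| = (normc x)%:C.
Proof. by case: x => a b; rewrite normc_def. Qed.

Lemma normc_ge0 x : 0 <= normc x.
Proof. by case: x => a b; exact: sqrtr_ge0. Qed.

Lemma normcJ x : normc (Num.conj x) = normc x.
Proof. by apply: complexI; rewrite -!normr_normc norm_conjC. Qed.

Lemma normcR (a : R) : normc a%:C = `|a|.
Proof. by rewrite /normc /= expr0n addr0 sqrtr_sqr. Qed.

Lemma conj_realC (a : R) : Num.conj a%:C = a%:C.
Proof. exact: conjc_real. Qed.

Lemma normc_Re_le x : `|complex.Re x| <= normc x.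
Proof. by rewrite -lecR -normr_normc; exact: normc_ge_Re. Qed.

Lemma normc_Im_le x : `|complex.Im x| <= normc x.
Proof.
case: x => a b /=; rewrite -sqrtr_sqr ler_sqrt ?addr_ge0 ?sqr_ge0//.
by rewrite lerDr sqr_ge0.
Qed.

Lemma normc_le_ReIm x : normc x <= `|complex.Re x| + `|complex.Im x|.
Proof.
case: x => a b; rewrite [X in X <= _](_ : _ = normc (a%:C + (b%:C * 'i))); last first.
  congr normc; apply/eqP; rewrite eq_complex /=.
  by rewrite !(mul0r, mulr0, mulr1, addr0, add0r, subr0, oppr0) !eqxx.
apply: le_trans (le_normcD _ _) _; rewrite normcM !normcR.
by rewrite /normc /= expr0n add0r expr1n sqrtr1 mulr1.
Qed.

Lemma normc_sum I (r : seq I) (P : pred I) (F : I -> R[i]) :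
  normc (\sum_(i <- r | P i) F i) <= \sum_(i <- r | P i) normc (F i).
Proof.
elim/big_ind2: _ => //; first by rewrite normc0.
by move=> a b c d ab cd; apply: le_trans (le_normcD _ _) _; exact: lerD.
Qed.

(** This norm is submultiplicative, invariant under adjoints and dominates each entry as well as
    [mxnorm2]; on unitary matrices it is bounded in terms of the dimension. *)
Definition nrm m n (A : 'M[R[i]]_(m, n)) : R := \sum_i \sum_j normc (A i j).

Lemma nrm_ge0 m n (A : 'M[R[i]]_(m, n)) : 0 <= nrm A.
Proof. by apply: sumr_ge0 => i _; apply: sumr_ge0 => j _; exact: normc_ge0. Qed.

Lemma normc_le_nrm m n (A : 'M[R[i]]_(m, n)) i j : normc (A i j) <= nrm A.
Proof.
rewrite /nrm (bigD1 i) //= (bigD1 j) //= -addrA lerDl addr_ge0//.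
  by apply: sumr_ge0 => k _; exact: normc_ge0.
by apply: sumr_ge0 => k _; apply: sumr_ge0 => l _; exact: normc_ge0.
Qed.

Lemma nrm0 m n : nrm (0 : 'M[R[i]]_(m, n)) = 0.
Proof. by rewrite /nrm big1// => i _; rewrite big1// => j _; rewrite mxE normc0. Qed.

Lemma nrmD m n (A B : 'M[R[i]]_(m, n)) : nrm (A + B) <= nrm A + nrm B.
Proof.
rewrite /nrm -big_split ler_sum// => i _; rewrite -big_split ler_sum// => j _.
by rewrite mxE; exact: le_normcD.
Qed.

Lemma nrmZ m n c (A : 'M[R[i]]_(m, n)) : nrm (c *: A) = normc c * nrm A.
Proof.
rewrite /nrm mulr_sumr; apply: eq_bigr => i _; rewrite mulr_sumr.
by apply: eq_bigr => j _; rewrite mxE normcM.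
Qed.

Lemma nrmN m n (A : 'M[R[i]]_(m, n)) : nrm (- A) = nrm A.
Proof. by rewrite -scaleN1r nrmZ normcN normc1 mul1r. Qed.

Lemma nrmB m n (A B : 'M[R[i]]_(m, n)) : nrm (A - B) <= nrm A + nrm B.
Proof. by rewrite -(nrmN B); exact: nrmD. Qed.

Lemma nrmBC m n (A B : 'M[R[i]]_(m, n)) : nrm (A - B) = nrm (B - A).
Proof. by rewrite -nrmN opprB. Qed.

Lemma nrm_trans m n (A B C : 'M[R[i]]_(m, n)) :
  nrm (A - C) <= nrm (A - B) + nrm (B - C).
Proof. by rewrite -[A in X in X <= _](subrK B) -addrA; exact: nrmD. Qed.

Lemma nrmM m n p (A : 'M[R[i]]_(m, n)) (B : 'M[R[i]]_(n, p)) :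
  nrm (A *m B) <= nrm A * nrm B.
Proof.
rewrite /nrm mulr_suml ler_sum// => i _.
rewrite mulr_suml.
apply: (@le_trans _ _ (\sum_j \sum_k normc (A i k) * normc (B k j))).
  apply: ler_sum => j _; rewrite mxE; apply: le_trans (normc_sum _ _ _) _.
  by apply: ler_sum => k _; rewrite normcM.
rewrite exchange_big/=; apply: ler_sum => k _.
rewrite -mulr_sumr ler_wpM2l ?normc_ge0// (bigD1 k)//= lerDl.
apply: sumr_ge0 => l _.
by apply: sumr_ge0 => j _; exact: normc_ge0.
Qed.

Lemma nrm_adj m n (A : 'M[R[i]]_(m, n)) : nrm (A^t* ) = nrm A.
Proof.
rewrite /nrm exchange_big/=; apply: eq_bigr => i _; apply: eq_bigr => j _.
by rewrite !mxE normcJ.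
Qed.

Lemma nrm_le m n (A : 'M[R[i]]_(m, n)) (c : R) :
  (forall i j, normc (A i j) <= c) -> nrm A <= m%:R * n%:R * c.
Proof.
move=> Ac; apply: (@le_trans _ _ (\sum_(i < m) \sum_(j < n) c)).
  by apply: ler_sum => i _; apply: ler_sum => j _.
by rewrite !sumr_const !card_ord -mulrnA mulr_natl mulrnAl mulr_natl -mulrnA mulnC.
Qed.

Lemma sqr_normc_Cnorm x : (normc x ^+ 2)%:C = x * Num.conj x.
Proof. by rewrite rmorphXn /= -normr_normc normCK. Qed.

Lemma normc1_invE x : normc x = 1 -> x^-1 = Num.conj x.
Proof.
move=> x1; have e : x * Num.conj x = 1 by rewrite -sqr_normc_Cnorm x1 expr1n.
have x0 : x != 0 by apply: contra_eqN e => /eqP ->; rewrite mul0r eq_sym oner_eq0.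
by apply: (mulfI x0); rewrite mulfV.
Qed.

Lemma mxnorm2_ge0 m n (A : 'M[R[i]]_(m, n)) : 0 <= mxnorm2 A.
Proof. exact: sqrtr_ge0. Qed.

Lemma sqr_mxnorm2 m n (A : 'M[R[i]]_(m, n)) :
  mxnorm2 A ^+ 2 = \sum_i \sum_j normc (A i j) ^+ 2.
Proof.
by rewrite sqr_sqrtr// sumr_ge0// => i _; rewrite sumr_ge0// => j _; exact: sqr_ge0.
Qed.

Lemma mxnorm2_le_nrm m n (A : 'M[R[i]]_(m, n)) : mxnorm2 A <= nrm A.
Proof.
rewrite -(@ler_pXn2r _ 2)// ?nnegrE ?mxnorm2_ge0 ?nrm_ge0// sqr_mxnorm2.
rewrite expr2 {2}/nrm mulr_suml ler_sum// => i _; rewrite mulr_suml.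
by apply: ler_sum => j _; rewrite expr2 ler_wpM2l ?normc_ge0 ?normc_le_nrm.
Qed.

Lemma sqr_mxnorm2_cV n (v : 'cV[R[i]]_n) : (mxnorm2 v ^+ 2)%:C = (v^t* *m v) 0 0.
Proof.
rewrite sqr_mxnorm2 mxE rmorph_sum; apply: eq_bigr => i _.
by rewrite big_ord1 [LHS]sqr_normc_Cnorm !mxE mulrC.
Qed.

Lemma unitarymx_entry_le n (U : 'M[R[i]]_n) i j : U \is unitarymx -> normc (U i j) <= 1.
Proof.
move=> /unitarymxP /matrixP /(_ i i); rewrite !mxE eqxx => UU.
have : \sum_k normc (U i k) ^+ 2 = 1.
  apply: complexI; rewrite rmorph_sum /= -[RHS]UU; apply: eq_bigr => k _.
  by rewrite sqr_normc_Cnorm !mxE.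
rewrite (bigD1 j)//= => e.
rewrite -(@expr_le1 _ 2)// ?normc_ge0// -e lerDl.
by apply: sumr_ge0 => k _; exact: sqr_ge0.
Qed.

Lemma unitarymxM n (U V : 'M[R[i]]_n) :
  U \is unitarymx -> V \is unitarymx -> U *m V \is unitarymx.
Proof. by move=> UU VU; rewrite mul_unitarymx. Qed.

Lemma unitarymx1 n : (1%:M : 'M[R[i]]_n) \is unitarymx.
Proof. by apply/unitarymxP; rewrite trmx1 map_mx1 mulmx1. Qed.

Lemma nrm_unitarymx n (U : 'M[R[i]]_n) : U \is unitarymx -> nrm U <= n%:R * n%:R.
Proof.
by move=> UU; rewrite -[leRHS]mulr1; apply: nrm_le => i j; exact: unitarymx_entry_le.
Qed.

End ComplexMatrixNorm.

(** * Tangent functions of a group of unitary-valued functions *)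

Section TangentSpace.
Context {R : realType} {T : Type} {N : nat}.
Implicit Types X Y : T -> 'M[R[i]]_N.

Definition nrm_bounded X := exists2 M : R, 0 < M & forall x, nrm (X x) <= M.

Lemma nrm_boundedD X Y :
  nrm_bounded X -> nrm_bounded Y -> nrm_bounded (fun x => X x + Y x).
Proof.
move=> [M M0 XM] [M' M'0 YM]; exists (M + M'); first exact: addr_gt0.
by move=> x; apply: le_trans (nrmD _ _) _; exact: lerD.
Qed.

Lemma nrm_boundedZ (c : R[i]) X : nrm_bounded X -> nrm_bounded (fun x => c *: X x).
Proof.
move=> [M M0 XM]; exists ((normc c + 1) * M).
  by rewrite mulr_gt0// ltr_wpDl ?normc_ge0.
by move=> x; rewrite nrmZ ler_pM ?normc_ge0 ?nrm_ge0// lerDl.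
Qed.

Lemma nrm_boundedM X Y :
  nrm_bounded X -> nrm_bounded Y -> nrm_bounded (fun x => X x *m Y x).
Proof.
move=> [M M0 XM] [M' M'0 YM]; exists (M * M'); first exact: mulr_gt0.
by move=> x; apply: le_trans (nrmM _ _) _; rewrite ler_pM ?nrm_ge0.
Qed.

Definition unitary_group (G : (T -> 'M[R[i]]_N) -> Prop) :=
  [/\ G (fun=> 1%:M), forall f g, G f -> G g -> G (fun x => f x *m g x),
      forall f, G f -> G (fun x => (f x)^t* ) &
      forall f, G f -> forall x, f x \is unitarymx].

Context (G : (T -> 'M[R[i]]_N) -> Prop).
Hypothesis hG : unitary_group G.

Let G1 : G (fun=> 1%:M). Proof. by case: hG. Qed.
Let GM f g : G f -> G g -> G (fun x => f x *m g x). Proof. by case: hG => _ + _ _; exact. Qed.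
Let GV f : G f -> G (fun x => (f x)^t* ). Proof. by case: hG => _ _ + _; exact. Qed.
Let GU f : G f -> forall x, f x \is unitarymx. Proof. by case: hG => _ _ _; exact. Qed.

(** Only small positive t occur and g may depend on t in any way, so no one-parameter group has to
    be exhibited. The boundedness of X controls the second-order terms of products. *)
Definition tangent X := nrm_bounded X /\
  forall e : R, 0 < e -> exists2 d : R, 0 < d &
    forall t, 0 < t < d ->
    exists2 g, G g & forall x, nrm (g x - 1%:M - t%:C *: X x) <= e * t.

(** Bounds [nrm] on the members of G; the added 1 keeps it positive even for N = 0. *)
Let K : R := N%:R * N%:R + 1.

Let K0 : 0 < K. Proof. by rewrite /K ltr_wpDl// mulr_ge0. Qed.

Let GK f x : G f -> nrm (f x) <= K.
Proof.
move=> Gf; apply: le_trans (nrm_unitarymx (GU Gf x)) _.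
by rewrite lerDl.
Qed.

Let GJ f x : G f -> f x *m (f x)^t* = 1%:M.
Proof. by move=> Gf; apply/unitarymxP; exact: GU. Qed.

Let JG f x : G f -> (f x)^t* *m f x = 1%:M.
Proof. by move=> Gf; apply/mulmx1C/GJ. Qed.

(** The permitted error e * t is proportional to t, and so is the error t * (Y - X) of replacing X
    by a uniformly close Y. *)
Lemma tangent_closed X : nrm_bounded X ->
  (forall e : R, 0 < e ->
     exists2 Y, tangent Y & forall x, nrm (Y x - X x) <= e) ->
  tangent X.
Proof.
move=> bX XY; split=> // e e0; have e20 : 0 < e / 2 by rewrite divr_gt0.
have [Y [_ /(_ _ e20)[d d0 tY]] YX] := XY _ e20.
exists d => // t td; have [g Gg gY] := tY _ td; exists g => // x.
have /andP[t0 _] := td.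
rewrite (_ : _ - _ = (g x - 1%:M - t%:C *: Y x) + t%:C *: (Y x - X x)); last first.
  by rewrite scalerBr addrA subrK.
apply: le_trans (nrmD _ _) _; rewrite nrmZ normcR gtr0_norm//.
rewrite [leRHS](_ : _ = e / 2 * t + t * (e / 2)); last by field.
by apply: lerD => //; rewrite ler_pM2l.
Qed.

Lemma eq_tangent X Y : X =1 Y -> tangent X -> tangent Y.
Proof. by move=> /funext ->. Qed.

Lemma tangent0 : tangent (fun=> 0).
Proof.
split; first by exists 1 => // x; rewrite nrm0.
move=> e e0; exists 1 => // t /andP[t0 _]; exists (fun=> 1%:M) => // x.
by rewrite subrr scaler0 subr0 nrm0 mulr_ge0 ?ltW.
Qed.

Lemma tangent_near1 X (M e t : R) g : 0 < t ->
  (forall x, nrm (X x) <= M) ->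
  (forall x, nrm (g x - 1%:M - t%:C *: X x) <= e * t) ->
  forall x, nrm (g x - 1%:M) <= (M + e) * t.
Proof.
move=> t0 XM gX x; rewrite -[g x - _](subrK (t%:C *: X x)).
apply: le_trans (nrmD _ _) _; rewrite nrmZ normcR gtr0_norm// mulrDl addrC lerD//.
by rewrite mulrC ler_pM2r.
Qed.

Lemma tangentD X Y : tangent X -> tangent Y -> tangent (fun x => X x + Y x).
Proof.
move=> [[M M0 XM] tX] [[M' M'0 YM] tY]; split.
  by apply: nrm_boundedD; [exists M|exists M'].
move=> e e0.
pose a := e / (3 * K); have a0 : 0 < a by rewrite divr_gt0// mulr_gt0.
have [d1 d10 {}tX] := tX _ a0; have [d2 d20 {}tY] := tY _ a0.
(* For t < d3 the middle term of the decomposition below, of size M * (M' + a) * t ^+ 2, stays under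
   e / 3 * t. *)
pose d3 := e / (3 * (M * (M' + a))).
have d30 : 0 < d3 by rewrite divr_gt0// !mulr_gt0// addr_gt0.
exists (Num.min d1 (Num.min d2 d3)); first by rewrite !lt_min d10 d20.
move=> t /andP[t0]; rewrite !lt_min => /and3P[td1 td2 td3].
have [|g Gg gX] := tX t; first by rewrite t0.
have [|h Gh hY] := tY t; first by rewrite t0.
exists (fun x => g x *m h x); first exact: GM.
move=> x; have h1 := tangent_near1 t0 YM hY x.
rewrite (_ : _ - _ = (g x - 1%:M - t%:C *: X x) *m h x
    + t%:C *: (X x *m (h x - 1%:M)) + (h x - 1%:M - t%:C *: Y x)); last first.
  rewrite mulmxBr mulmx1 scalerBr !mulmxBl mul1mx -scalemxAl scalerDr.
  move: (g x *m h x) (t%:C *: X x *m h x) (t%:C *: X x) (t%:C *: Y x) => A B C D.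
  by apply/matrixP => i j; rewrite !mxE; ring.
have a1 : nrm ((g x - 1%:M - t%:C *: X x) *m h x) <= e / 3 * t.
  apply: le_trans (nrmM _ _) _.
  apply: (@le_trans _ _ (a * t * K)).
    by rewrite ler_pM ?nrm_ge0// GK.
  by rewrite le_eqVlt; apply/orP; left; apply/eqP; rewrite /a; field; rewrite gt_eqF.
have a2 : nrm (t%:C *: (X x *m (h x - 1%:M))) <= e / 3 * t.
  rewrite nrmZ normcR gtr0_norm// mulrC ler_pM2r//.
  apply: le_trans (nrmM _ _) _.
  apply: (@le_trans _ _ (M * ((M' + a) * t))); first by rewrite ler_pM ?nrm_ge0.
  rewrite mulrA -ler_pdivlMl ?mulr_gt0 ?(addr_gt0 M'0 a0)//.
  apply/ltW/(lt_le_trans td3); rewrite /d3 le_eqVlt; apply/orP; left; apply/eqP.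
  by field; rewrite !gt_eqF ?(addr_gt0 M'0 a0).
have a3 : nrm (h x - 1%:M - t%:C *: Y x) <= e / 3 * t.
  apply: le_trans (hY x) _; rewrite ler_pM2r// /a ler_pdivrMr ?mulr_gt0//.
  rewrite [leRHS](_ : _ = e * K); last by field.
  by rewrite ler_peMr ?(ltW e0)// /K lerDr mulr_ge0.
apply: le_trans (nrmD _ _) _; rewrite [leRHS](_ : _ = e / 3 * t + e / 3 * t + e / 3 * t).
  by rewrite lerD//; apply: le_trans (nrmD _ _) _; rewrite lerD.
by field.
Qed.

(** The inverse g^* of g = 1 + t X + o(t) is 1 - t X + o(t): g^* - 1 + t X is t g^* (g - 1) X, of
    order t^2, minus g^* times the remainder of g. *)
Lemma tangentN X : tangent X -> tangent (fun x => - X x).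
Proof.
move=> [[M M0 XM] tX]; split; first by exists M => // x; rewrite nrmN.
move=> e e0.
pose a := e / (2 * K); have a0 : 0 < a by rewrite divr_gt0// mulr_gt0.
have [d1 d10 {}tX] := tX _ a0.
pose d2 := e / (2 * (K * M * (M + a))).
have d20 : 0 < d2 by rewrite divr_gt0// !mulr_gt0// addr_gt0.
exists (Num.min d1 d2); first by rewrite !lt_min d10.
move=> t /andP[t0]; rewrite !lt_min => /andP[td1 td2].
have [|g Gg gX] := tX t; first by rewrite t0.
exists (fun x => (g x)^t* ); first exact: GV.
move=> x; have g1 := tangent_near1 t0 XM gX x.
rewrite (_ : _ - _ = t%:C *: ((g x)^t* *m (g x - 1%:M) *m X x)
    - (g x)^t* *m (g x - 1%:M - t%:C *: X x)); last first.
  rewrite !mulmxBr !mulmxBl mulmx1 JG// mul1mx -scalemxAr !scalerBr scalerN.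
  move: ((g x)^t* ) (t%:C *: X x) (t%:C *: ((g x)^t* *m X x)) => A B C.
  by apply/matrixP => i j; rewrite !mxE; ring.
have a1 : nrm (t%:C *: ((g x)^t* *m (g x - 1%:M) *m X x)) <= e / 2 * t.
  rewrite nrmZ normcR gtr0_norm// mulrC ler_pM2r//.
  apply: (@le_trans _ _ (K * ((M + a) * t) * M)).
    apply: le_trans (nrmM _ _) _; rewrite ler_pM ?nrm_ge0//.
    by apply: le_trans (nrmM _ _) _; rewrite ler_pM ?nrm_ge0// nrm_adj GK.
  rewrite [leLHS](_ : _ = K * M * (M + a) * t); last by ring.
  rewrite -ler_pdivlMl ?mulr_gt0 ?(addr_gt0 M0 a0)//.
  apply/ltW/(lt_le_trans td2); rewrite /d2 le_eqVlt; apply/orP; left; apply/eqP.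
  by field; rewrite !gt_eqF ?(addr_gt0 M0 a0).
have a2 : nrm ((g x)^t* *m (g x - 1%:M - t%:C *: X x)) <= e / 2 * t.
  apply: le_trans (nrmM _ _) _.
  apply: (@le_trans _ _ (K * (a * t))).
    by rewrite ler_pM ?nrm_ge0// nrm_adj GK.
  by rewrite le_eqVlt; apply/orP; left; apply/eqP; rewrite /a; field; rewrite gt_eqF.
apply: le_trans (nrmB _ _) _; rewrite [leRHS](_ : _ = e / 2 * t + e / 2 * t).
  exact: lerD.
by field.
Qed.

Lemma tangentZ (c : R) X : tangent X -> tangent (fun x => c%:C *: X x).
Proof.
(* Rescaling t by c needs c > 0; negative factors go through [tangentN]. *)
wlog c0 : c X / 0 <= c.
  move=> W tX; have [c0|c0] := leP 0 c; first exact: W.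
  apply: (@eq_tangent (fun x => (- c)%:C *: - X x)).
    by move=> x; rewrite rmorphN scaleNr scalerN opprK.
  by apply: W; [rewrite oppr_ge0 ltW|exact: tangentN].
move=> [bX tX]; have [->|cn0] := eqVneq c 0.
  by apply: eq_tangent tangent0 => x; rewrite scale0r.
have {cn0}c0 : 0 < c by rewrite lt_def cn0.
split=> [|e e0]; first exact: nrm_boundedZ.
have [|d d0 {}tX] := tX (e / c); first by rewrite divr_gt0.
exists (d / c); first by rewrite divr_gt0.
move=> t /andP[t0 td]; have [|g Gg gX] := tX (c * t).
  by rewrite mulr_gt0//= mulrC -ltr_pdivlMr.
exists g => // x; rewrite scalerA -rmorphM mulrC; apply: le_trans (gX x) _.
by rewrite mulrA divfK ?gt_eqF.
Qed.

Lemma tangentB X Y : tangent X -> tangent Y -> tangent (fun x => X x - Y x).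
Proof. by move=> tX tY; apply: tangentD => //; exact: tangentN. Qed.

Lemma tangent_sum I (r : seq I) (P : pred I) (F : I -> T -> 'M[R[i]]_N) :
  (forall i, P i -> tangent (F i)) -> tangent (fun x => \sum_(i <- r | P i) F i x).
Proof.
move=> tF; elim: r => [|i r IH].
  by apply: eq_tangent tangent0 => x; rewrite big_nil.
case Pi : (P i); last by apply: eq_tangent IH => x; rewrite big_cons Pi.
apply: eq_tangent (tangentD (tF _ Pi) IH) => x.
by rewrite big_cons Pi.
Qed.

(** Here g need be neither constant nor close to 1: conjugating a constant X by the phases is what
    produces non-constant tangent functions. *)
Lemma tangent_conj g X : G g -> tangent X -> tangent (fun x => g x *m X x *m (g x)^t* ).
Proof.
move=> Gg [bX tX]; split.
  have bg : nrm_bounded g by exists K => // x; exact: GK.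
  have bg' : nrm_bounded (fun x => (g x)^t* ).
    by exists K => // x; rewrite nrm_adj GK.
  by do 2!apply: nrm_boundedM => //.
move=> e e0; have [|d d0 {}tX] := tX (e / (K * K)); first by rewrite divr_gt0// mulr_gt0.
exists d => // t td; have [h Gh hX] := tX _ td.
exists (fun x => g x *m h x *m (g x)^t* ).
  by apply: GM; [exact: GM|exact: GV].
move=> x; rewrite (_ : _ - _ = g x *m (h x - 1%:M - t%:C *: X x) *m (g x)^t* ).
  apply: (@le_trans _ _ (K * (e / (K * K) * t) * K)).
    apply: le_trans (nrmM _ _) _; rewrite ler_pM ?nrm_ge0//.
      by apply: le_trans (nrmM _ _) _; rewrite ler_pM ?nrm_ge0// GK.
    by rewrite nrm_adj GK.
  by rewrite le_eqVlt; apply/orP; left; apply/eqP; field; rewrite gt_eqF.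
by rewrite !mulmxBr !mulmxBl mulmx1 GJ// -scalemxAr -scalemxAl.
Qed.

(* [X, Y] is the uniform limit of (g Y g^* - Y) / s where g = 1 + s X + o(s). *)
Lemma tangent_commutator X Y : tangent X -> tangent Y ->
  tangent (fun x => X x *m Y x - Y x *m X x).
Proof.
move=> [bX tX] tY; have bY := tY.1.
have bXY : nrm_bounded (fun x => X x *m Y x - Y x *m X x).
  have := nrm_boundedD (nrm_boundedM bX bY) (nrm_boundedZ (-1) (nrm_boundedM bY bX)).
  by under eq_fun do rewrite scaleN1r.
apply: tangent_closed => // e e0.
case: bX bY bXY => [M M0 XM] [M' M'0 YM] [C C0 XYC].
(* After division by s the remainder r of g contributes at most 2 * M' * K * a = e / 2, whatever s
   is; the other error term is made small by the choice of s. *)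
pose a := e / (4 * M' * K); have a0 : 0 < a by rewrite divr_gt0// !mulr_gt0.
have [d d0 {}tX] := tX _ a0.
pose s := Num.min (d / 2) (e / (2 * C * (M + a))).
have s0 : 0 < s by rewrite lt_min !divr_gt0 ?mulr_gt0 ?addr_gt0.
have [|g Gg gX] := tX s.
  by rewrite s0 /= gt_min ltr_pdivrMr// ltr_pMr// ltr1n.
exists (fun x => (s^-1)%:C *: (g x *m Y x *m (g x)^t* - Y x)).
  by apply: tangentZ; apply: tangentB => //; exact: tangent_conj.
move=> x; have g1 := tangent_near1 s0 XM gX x.
pose r := g x - 1%:M - s%:C *: X x.
have gE : g x = 1%:M + s%:C *: X x + r.
  by rewrite /r; move: (s%:C *: X x) => A; apply/matrixP => i j; rewrite !mxE; ring.
have rs : nrm r <= a * s by exact: gX.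
clearbody r.
have sC : (s%:C : R[i]) != 0 by rewrite (inj_eq (@complexI _)) gt_eqF.
have -> : (s^-1)%:C *: (g x *m Y x *m (g x)^t* - Y x) - (X x *m Y x - Y x *m X x)
  = (X x *m Y x - Y x *m X x) *m ((g x)^t* - 1%:M)
    + (s^-1)%:C *: ((r *m Y x - Y x *m r) *m (g x)^t* ).
  have -> : g x *m Y x *m (g x)^t* - Y x = (g x *m Y x - Y x *m g x) *m (g x)^t*.
    by rewrite mulmxBl -(mulmxA (Y x)) GJ// mulmx1.
  have -> : g x *m Y x - Y x *m g x =
      s%:C *: (X x *m Y x - Y x *m X x) + (r *m Y x - Y x *m r).
    rewrite [in LHS]gE !mulmxDl !mulmxDr mul1mx mulmx1 -scalemxAl -scalemxAr scalerBr.
    move: (s%:C *: (X x *m Y x)) (s%:C *: (Y x *m X x)) (r *m Y x) (Y x *m r) => A B D E.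
    by apply/matrixP => i j; rewrite !mxE; ring.
  move: (X x *m Y x - Y x *m X x) (r *m Y x - Y x *m r) => A B.
  rewrite mulmxDl scalerDr mulmxBr mulmx1 -scalemxAl scalerA -rmorphM mulVf ?gt_eqF//.
  by rewrite scale1r addrAC.
have a1 : nrm ((X x *m Y x - Y x *m X x) *m ((g x)^t* - 1%:M)) <= e / 2.
  apply: (@le_trans _ _ (C * ((M + a) * s))).
    apply: le_trans (nrmM _ _) _; rewrite ler_pM ?nrm_ge0//.
    rewrite (_ : _ - _ = (g x - 1%:M)^t* ) ?nrm_adj//.
    by rewrite linearB/= map_mxB trmx1 map_mx1.
  rewrite mulrA -ler_pdivlMl ?mulr_gt0 ?(addr_gt0 M0 a0)//.
  rewrite ge_min; apply/orP; right; rewrite le_eqVlt; apply/orP; left; apply/eqP.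
  by field; rewrite !gt_eqF ?(addr_gt0 M0 a0).
have a2 : nrm ((s^-1)%:C *: ((r *m Y x - Y x *m r) *m (g x)^t* )) <= e / 2.
  rewrite nrmZ normcR gtr0_norm ?invr_gt0// ler_pdivrMl//.
  apply: (@le_trans _ _ ((a * s * M' + M' * (a * s)) * K)).
    apply: le_trans (nrmM _ _) _; rewrite ler_pM ?nrm_ge0// ?nrm_adj ?GK//.
    apply: le_trans (nrmB _ _) _; apply: lerD; apply: le_trans (nrmM _ _) _;
      by rewrite ler_pM ?nrm_ge0.
  by rewrite le_eqVlt; apply/orP; left; apply/eqP; rewrite /a; field; rewrite !gt_eqF.
by apply: le_trans (nrmD _ _) _; rewrite [leRHS](splitr e) lerD.
Qed.

End TangentSpace.

(** * Exponentials of skew-Hermitian matrices *)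

Section Cis.
Context {R : realType}.
Implicit Types a b t : R.

Definition cis t : R[i] := cos t +i* sin t.

Lemma cis0 : cis 0 = 1.
Proof. by rewrite /cis cos0 sin0. Qed.

Lemma cisD a b : cis (a + b) = cis a * cis b.
Proof.
apply/eqP; rewrite eq_complex /= cosD sinD; apply/andP; split; apply/eqP => //.
by rewrite addrC [X in X + _]mulrC [X in _ + X]mulrC addrC mulrC.
Qed.

Lemma cisN t : cis (- t) = Num.conj (cis t).
Proof. by rewrite /cis cosN sinN. Qed.

Lemma normc_cis t : normc (cis t) = 1.
Proof. by rewrite /normc /= cos2Dsin2 sqrtr1. Qed.

Lemma cis_sum I (r : seq I) (P : pred I) (F : I -> R) :
  cis (\sum_(i <- r | P i) F i) = \prod_(i <- r | P i) cis (F i).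
Proof. exact: (big_morph cis cisD cis0). Qed.

Lemma abs_sin_le t : `|sin t| <= `|t|.
Proof.
wlog t0 : t / 0 <= t.
  move=> W; have [|t0] := leP 0 t; first exact: W.
  by have := W (- t); rewrite sinN !normrN; apply; rewrite oppr_ge0 ltW.
have [|c _] := @MVT_segment R sin cos 0 t t0 (fun x _ => is_derive_sin x).
  exact/continuous_subspaceT/continuous_sin.
by rewrite sin0 !subr0 => ->; rewrite normrM ler_piMl// cos_max.
Qed.

Lemma abs_cosB1_le t : `|cos t - 1| <= `|t| ^+ 2.
Proof.
wlog t0 : t / 0 <= t.
  move=> W; have [|t0] := leP 0 t; first exact: W.
  by have := W (- t); rewrite cosN !normrN; apply; rewrite oppr_ge0 ltW.
have [|c ct] := @MVT_segment R cos (fun x => - sin x) 0 t t0 (fun x _ => is_derive_cos x).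
  exact/continuous_subspaceT/continuous_cos.
rewrite cos0 !subr0 => ->; rewrite normrM normrN expr2 ler_wpM2r//.
apply: le_trans (abs_sin_le _) _; move: ct; rewrite in_itv/= => /andP[c0 ct].
by rewrite !ger0_norm.
Qed.

Lemma abs_sinB_le t : `|sin t - t| <= `|t| ^+ 2 * `|t|.
Proof.
wlog t0 : t / 0 <= t.
  move=> W; have [|t0] := leP 0 t; first exact: W.
  have := W (- t); rewrite sinN -opprD !normrN; apply; by rewrite oppr_ge0 ltW.
have dsB (x : R) : is_derive x 1 (fun x : R => sin x - x) (cos x - 1) by apply: is_deriveB.
have [|c ct] := @MVT_segment R _ _ 0 t t0 (fun x _ => dsB x).
  apply: continuous_subspaceT => x; apply: cvgB; last exact: cvg_id.
  exact: continuous_sin.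
rewrite sin0 !subr0 => ->; rewrite normrM ler_wpM2r//.
apply: le_trans (abs_cosB1_le _) _; move: ct; rewrite in_itv/= => /andP[c0 ct].
by rewrite !ger0_norm// ler_pXn2r// nnegrE.
Qed.

Lemma cis_taylor1 t : normc (cis t - 1 - 0 +i* t) <= `|t| ^+ 2 * (1 + `|t|).
Proof.
apply: le_trans (normc_le_ReIm _) _; rewrite /= !subr0 mulrDr mulr1 lerD//.
  exact: abs_cosB1_le.
exact: abs_sinB_le.
Qed.

Lemma cis_lipschitz a b : normc (cis a - cis b) <= 3 * `|a - b|.
Proof.
have -> : cis a - cis b = cis b * (cis (a - b) - 1).
  by rewrite mulrBr mulr1 -cisD addrCA subrr addr0.
rewrite normcM normc_cis mul1r; move: (a - b) => t.
apply: le_trans (normc_le_ReIm _) _; rewrite /= subr0.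
have s : `|sin t| <= `|t| := abs_sin_le t.
suff : `|cos t - 1| <= 2 * `|t| by lra.
have [t1|t1] := leP `|t| 1.
  apply: le_trans (abs_cosB1_le _) _; rewrite expr2 ler_wpM2r//.
  by apply: le_trans t1 _; lra.
apply: (@le_trans _ _ 2); last by lra.
have /andP[] : -1 <= cos t <= 1 by rewrite cos_geN1 cos_le1.
by rewrite ler_norml => ? ?; apply/andP; split; lra.
Qed.

Lemma cis_onto (c : R[i]) : normc c = 1 -> exists t, cis t = c.
Proof.
case: c => a b; rewrite /normc => e.
have ab : a ^+ 2 + b ^+ 2 = 1.
  by rewrite -[LHS]sqr_sqrtr ?e ?expr1n// addr_ge0 ?sqr_ge0.
have a1 : -1 <= a <= 1.
  rewrite -ler_norml -(@expr_le1 _ 2)// real_normK ?num_real//.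
  by rewrite -ab lerDl sqr_ge0.
have sb : Num.sqrt (1 - a ^+ 2) = `|b|.
  by rewrite -ab addrAC subrr add0r sqrtr_sqr.
have [b0|b0] := leP 0 b.
  exists (acos a); rewrite /cis acosK ?in_itv// sin_acos// sb.
  by rewrite ger0_norm.
exists (- acos a); rewrite /cis cosN sinN acosK ?in_itv// sin_acos// sb.
by rewrite ltr0_norm// opprK.
Qed.

End Cis.

Section UnitaryExponential.
Context {R : realType} {N : nat}.
Variables (W : 'M[R[i]]_N) (th : 'rV[R]_N).
Hypothesis WU : W \is unitarymx.

(** The one-parameter group generated by the skew-Hermitian [genmx], written through a unitary
    diagonalisation with eigenvalues i th_j, so that all estimates reduce to those of [cis]. *)
Definition expmx (a : R) : 'M[R[i]]_N :=
  W^t* *m diag_mx (\row_j cis (th 0 j * a)) *m W.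

Definition genmx : 'M[R[i]]_N :=
  W^t* *m diag_mx (\row_j (0 +i* th 0 j)) *m W.

Let WW : W *m W^t* = 1%:M. Proof. exact/unitarymxP. Qed.
Let WW' : W^t* *m W = 1%:M. Proof. exact/mulmx1C. Qed.

Lemma expmx0 : expmx 0 = 1%:M.
Proof.
rewrite /expmx (_ : diag_mx _ = 1%:M) ?mulmx1//.
by apply/matrixP => i j; rewrite !mxE mulr0 cis0.
Qed.

Lemma expmxD a b : expmx (a + b) = expmx a *m expmx b.
Proof.
rewrite /expmx !mulmxA; congr (_ *m W); rewrite -!mulmxA; congr (_ *m _).
rewrite (mulmxA W) WW mul1mx mulmx_diag; congr diag_mx.
by apply/rowP => j; rewrite !mxE mulrDr cisD.
Qed.

Lemma expmx_adj a : (expmx a)^t* = expmx (- a).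
Proof.
rewrite /expmx !trmx_mul !map_mxM /= trmxCK -mulmxA; congr (_ *m (_ *m _)).
by apply/matrixP => i j; rewrite !mxE rmorphMn /= mulrN cisN eq_sym; case: eqP => [->|].
Qed.

Lemma expmx_unitary a : expmx a \is unitarymx.
Proof. by apply/unitarymxP; rewrite expmx_adj -expmxD subrr expmx0. Qed.

Lemma mxtrace_genmx : \sum_j th 0 j = 0 -> \tr genmx = 0.
Proof.
move=> s0; rewrite /genmx -mulmxA mxtrace_mulC -mulmxA WW mulmx1 mxtrace_diag.
under eq_bigr do rewrite mxE.
apply/eqP; rewrite eq_complex /=; apply/andP; split; apply/eqP.
  by rewrite (raddf_sum (@complex.Re R : Rcomplex R -> R)) big1.
by rewrite (raddf_sum (@complex.Im R : Rcomplex R -> R)) /= s0.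
Qed.

Lemma genmx_adj : genmx^t* = - genmx.
Proof.
rewrite /genmx !trmx_mul !map_mxM /= trmxCK -mulNmx -mulmxN mulmxA.
congr (_ *m _ *m _); apply/matrixP => i j; rewrite !mxE rmorphMn /= eq_sym.
by case: eqP => [->|]; rewrite ?oppr0// mulr1n/=; apply/eqP; rewrite eq_complex/= oppr0 !eqxx.
Qed.

Let K : R := N%:R * N%:R.

Lemma nrm_diag_mx (d : 'rV[R[i]]_N) : nrm (diag_mx d) = \sum_j normc (d 0 j).
Proof.
apply: eq_bigr => i _; rewrite (bigD1 i)//= mxE eqxx mulr1n big1 ?addr0// => j ji.
by rewrite mxE eq_sym (negbTE ji) mulr0n normc0.
Qed.

Lemma nrm_diag_conj (d : 'rV[R[i]]_N) :
  nrm (W^t* *m diag_mx d *m W) <= K * (\sum_j normc (d 0 j)) * K.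
Proof.
have WK : nrm W <= K by exact: nrm_unitarymx.
apply: le_trans (nrmM _ _) _; rewrite ler_pM ?nrm_ge0//.
by apply: le_trans (nrmM _ _) _; rewrite ler_pM ?nrm_ge0 ?nrm_adj// nrm_diag_mx.
Qed.

Lemma expmx_lipschitz :
  exists2 C : R, 0 < C & forall a b, nrm (expmx a - expmx b) <= C * `|a - b|.
Proof.
pose S := \sum_j 3 * `|th 0 j|; have S0 : 0 <= S.
  by apply: sumr_ge0 => j _; rewrite mulr_ge0.
have K0 : 0 <= K by rewrite mulr_ge0.
exists (K * S * K + 1); first by rewrite ltr_wpDl// !mulr_ge0.
move=> a b; rewrite /expmx -mulmxBl -mulmxBr -raddfB.
apply: le_trans (nrm_diag_conj _) _.
apply: (@le_trans _ _ (K * S * K * `|a - b|)); last first.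
  by rewrite mulrDl lerDl mul1r.
rewrite [leRHS](_ : _ = K * (S * `|a - b|) * K); last by ring.
rewrite ler_wpM2r// ler_wpM2l//.
rewrite [leRHS]mulr_suml ler_sum// => j _.
rewrite !mxE -mulrA -normrM mulrBr; exact: cis_lipschitz.
Qed.

Lemma expmx_taylor1 : exists2 C : R, 0 < C &
  forall a, `|a| <= 1 -> nrm (expmx a - 1%:M - a%:C *: genmx) <= C * a ^+ 2.
Proof.
pose S := \sum_j `|th 0 j| ^+ 2 * (1 + `|th 0 j|); have S0 : 0 <= S.
  by apply: sumr_ge0 => j _; rewrite mulr_ge0 ?sqr_ge0// addr_ge0.
have K0 : 0 <= K by rewrite mulr_ge0.
exists (K * S * K + 1); first by rewrite ltr_wpDl// !mulr_ge0.
move=> a a1.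
have -> : expmx a - 1%:M - a%:C *: genmx =
    W^t* *m diag_mx (\row_j (cis (th 0 j * a) - 1 - (0 +i* (th 0 j * a)))) *m W.
  rewrite (_ : diag_mx _ = diag_mx (\row_j cis (th 0 j * a)) - 1%:M
    - a%:C *: diag_mx (\row_j (0 +i* th 0 j))).
    by rewrite !mulmxBr !mulmxBl mulmx1 WW' -scalemxAr -scalemxAl.
  apply/matrixP => i j; rewrite !mxE.
  case: eqP => _; rewrite ?mulr1n ?mulr0n ?mulr0 ?subr0//; congr (_ - _).
  by apply/eqP; rewrite eq_complex /= !(mulr0,mul0r,subr0,addr0) mulrC !eqxx.
apply: le_trans (nrm_diag_conj _) _.
apply: (@le_trans _ _ (K * S * K * a ^+ 2)); last first.
  by rewrite mulrDl lerDl mul1r sqr_ge0.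
rewrite [leRHS](_ : _ = K * (S * a ^+ 2) * K); last by ring.
rewrite ler_wpM2r// ler_wpM2l//.
rewrite [leRHS]mulr_suml ler_sum// => j _.
rewrite mxE; apply: le_trans (cis_taylor1 _) _.
have ea : `|a| ^+ 2 = a ^+ 2 by rewrite real_normK ?num_real.
rewrite normrM exprMn ea.
rewrite [leRHS](_ : _ = `|th 0 j| ^+ 2 * a ^+ 2 * (1 + `|th 0 j|)); last by ring.
apply: ler_wpM2l; first by rewrite mulr_ge0 ?sqr_ge0.
by rewrite lerD2l ler_piMr.
Qed.

End UnitaryExponential.

(** * Exponentials of tangent functions as uniform limits *)

Section TangentExponential.
Context {R : realType} {T : Type} {N : nat}.
Context (G : (T -> 'M[R[i]]_N) -> Prop).
Hypothesis hG : unitary_group G.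
Variables (W : 'M[R[i]]_N) (th : 'rV[R]_N).
Hypothesis WU : W \is unitarymx.

Let K : R := N%:R * N%:R + 1.
Let K0 : 0 < K. Proof. by rewrite /K ltr_wpDl// mulr_ge0. Qed.
Let UK (U : 'M[R[i]]_N) : U \is unitarymx -> nrm U <= K.
Proof. by move=> /nrm_unitarymx /le_trans; apply; rewrite lerDl. Qed.

Definition mxpow (U : 'M[R[i]]_N) n : 'M[R[i]]_N := iter n (mulmx U) 1%:M.

(** Telescoping: powers of unitary matrices stay bounded by K, so the error is linear in n. The
    prefix Z absorbs the factors U that pile up on the left in the induction. *)
Lemma mxpow_close (U V : 'M[R[i]]_N) (d : R) n :
  U \is unitarymx -> V \is unitarymx -> nrm (U - V) <= d ->
  forall Z : 'M[R[i]]_N, Z \is unitarymx ->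
  nrm (Z *m (mxpow U n - mxpow V n)) <= n%:R * (K * d * K).
Proof.
move=> UU VU UV; elim: n => [|n IH] Z ZU /=.
  by rewrite subrr mulmx0 nrm0 mul0r.
have VnU : mxpow V n \is unitarymx.
  elim: n {IH} => [|n IH] /=; [exact: unitarymx1|exact: unitarymxM].
rewrite (_ : _ *m _ = Z *m U *m (mxpow U n - mxpow V n)
   + Z *m (U - V) *m mxpow V n); last first.
  by rewrite !mulmxBr !mulmxBl !mulmxA addrA subrK.
apply: le_trans (nrmD _ _) _; rewrite -natr1 mulrDl mul1r lerD//.
  by apply: IH; exact: unitarymxM.
apply: le_trans (nrmM _ _) _; rewrite ler_pM ?nrm_ge0 ?UK//.
apply: le_trans (nrmM _ _) _; rewrite ler_pM ?nrm_ge0 ?UK//.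
Qed.

(** exp (f X) is the n-th power of exp (f X / n), and some member of G is within o(1 / n) of the
    latter, uniformly; taking the power costs a factor of order n only. *)
Lemma tangent_expmx (f : T -> R) (M : R) : (forall x, `|f x| <= M) ->
  tangent G (fun x => (f x)%:C *: genmx W th) ->
  forall e, 0 < e -> exists2 g, G g & forall x, nrm (g x - expmx W th (f x)) <= e.
Proof.
move=> fM [_ tf] e e0; have [G1 GM _ GU] := hG.
wlog M0 : M fM / 0 < M.
  move=> W0; apply: (W0 (`|M| + 1)); last by rewrite ltr_wpDl.
  by move=> x; apply: le_trans (fM x) _; rewrite (le_trans (ler_norm _))// lerDl.
have [C C0 expC] := expmx_taylor1 th WU.
pose a := e / (2 * (K * K)); have a0 : 0 < a by rewrite divr_gt0// !mulr_gt0.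
have [d d0 {}tf] := tf _ a0.
(* The bound d serves tangency, M^-1 keeps |f x * t| <= 1 as [expmx_taylor1] asks, and the last one
   makes the quadratic Taylor error at most e / 2 after n.+1 factors. *)
pose d' := Num.min (Num.min d M^-1) (e / (2 * (K * K * (C * M ^+ 2)))).
have CM0 : 0 < C * M ^+ 2 by rewrite mulr_gt0// exprn_gt0.
have d'0 : 0 < d' by rewrite !lt_min d0 invr_gt0 M0 divr_gt0// !mulr_gt0.
have [n] : exists n, (n.+1%:R : R)^-1 < d'.
  by have [n _ /(_ n (leqnn n)) nd] := near_infty_natSinv_lt (PosNum d'0); exists n.
set t := n.+1%:R^-1; have t0 : 0 < t by rewrite invr_gt0 ltr0n.
rewrite !lt_min => /andP[/andP[td tM] te].
have [|g Gg gf] := tf t; first by rewrite t0.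
exists (fun x => mxpow (g x) n.+1).
  by elim: (n.+1) => [//|k IH]; apply: GM.
move=> x; have -> : expmx W th (f x) = mxpow (expmx W th (f x * t)) n.+1.
  have powE k b : mxpow (expmx W th b) k = expmx W th (b *+ k).
    elim: k => [|k IH]; first by rewrite mulr0n expmx0.
    by rewrite mulrS expmxD// -IH.
  by rewrite powE -[in RHS]mulr_natr -mulrA /t mulVf ?mulr1// pnatr_eq0.
have gu : nrm (g x - expmx W th (f x * t)) <= a * t + C * M ^+ 2 * t ^+ 2.
  apply: le_trans (nrm_trans _ (1%:M + t%:C *: ((f x)%:C *: genmx W th)) _) _.
  rewrite opprD addrA lerD//.
  rewrite nrmBC opprD addrA scalerA -rmorphM [t * f x]mulrC.
  have ft1 : `|f x * t| <= 1.
    rewrite normrM (gtr0_norm t0) -(@divff _ M) ?gt_eqF//.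
    by rewrite ler_pM// ltW.
  apply: le_trans (expC _ ft1) _.
  rewrite -mulrA ler_pM2l// exprMn ler_wpM2r ?sqr_ge0//.
  by rewrite -(real_normK (num_real (f x))) ler_pXn2r// nnegrE ltW.
have := mxpow_close n.+1 (GU _ Gg x) (expmx_unitary th WU (f x * t)) gu (unitarymx1 N).
rewrite mul1mx => /le_trans; apply.
have -> : (n.+1)%:R = t^-1 by rewrite /t invrK.
rewrite [leLHS](_ : _ = K * K * a + K * K * (C * M ^+ 2) * t); last first.
  by field; rewrite gt_eqF.
rewrite [leRHS]splitr lerD//.
  by rewrite /a le_eqVlt; apply/orP; left; apply/eqP; field; rewrite gt_eqF.
rewrite -ler_pdivlMl ?mulr_gt0//; apply/ltW/(lt_le_trans te).
rewrite le_eqVlt; apply/orP; left; apply/eqP; field.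
by rewrite !gt_eqF.
Qed.

End TangentExponential.

(** * Rotations in coordinate planes *)

Section PlaneRotations.
Context {R : realType} {N : nat}.
Implicit Types (a b c : 'I_N) (x y : R[i]).

(** The skew-Hermitian generator of a rotation in the plane of a and b. It is only real-linear in x,
    whence the real factor in [planemxZ]. *)
Definition planemx a b x : 'M[R[i]]_N :=
  x *: delta_mx a b - Num.conj x *: delta_mx b a.

Lemma planemxC a b x : planemx a b x = planemx b a (- Num.conj x).
Proof. by rewrite /planemx rmorphN /= conjCK !scaleNr opprK addrC. Qed.

Lemma planemxD a b x y : planemx a b (x + y) = planemx a b x + planemx a b y.
Proof. by rewrite /planemx rmorphD !scalerDl /= opprD addrACA. Qed.

Lemma planemxZ a b (t : R) x : planemx a b (t%:C * x) = t%:C *: planemx a b x.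
Proof.
by rewrite /planemx rmorphM /= conj_realC scalerBr !scalerA.
Qed.

Let mulZdelta a b c d x y : (x *: delta_mx a b) *m (y *: delta_mx c d) =
  (x * y) *: (delta_mx a d *+ (b == c)) :> 'M[R[i]]_N.
Proof. by rewrite -scalemxAl -scalemxAr scalerA mul_delta_mx_cond. Qed.

(** The only products of matrix units that survive are E_ab E_bc and E_cb E_ba, so the coefficients
    multiply. *)
Lemma planemx_commutator a b c x y : a != b -> b != c -> a != c ->
  planemx a b x *m planemx b c y - planemx b c y *m planemx a b x =
  planemx a c (x * y).
Proof.
move=> ab bc ac; rewrite /planemx !mulmxBl !mulmxBr !mulZdelta.
rewrite !eqxx (eq_sym c) (eq_sym b a) (eq_sym c b) (negbTE ab) (negbTE bc) (negbTE ac).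
rewrite !mulr0n !mulr1n !scaler0 rmorphM /=.
by move: (delta_mx a c) (delta_mx c a) => A B; apply/matrixP => i j; rewrite !mxE; ring.
Qed.

Lemma planemx_commutator_diag a b x y : a != b ->
  planemx a b x *m planemx a b y - planemx a b y *m planemx a b x =
  (Num.conj x * y - x * Num.conj y) *: (delta_mx a a - delta_mx b b).
Proof.
move=> ab; rewrite /planemx !mulmxBl !mulmxBr !mulZdelta.
rewrite !eqxx (eq_sym b) (negbTE ab) !mulr0n !mulr1n !scaler0.
move: (delta_mx a a) (delta_mx b b) => A B; apply/matrixP => i j; rewrite !mxE; ring.
Qed.

(** Each off-diagonal pair is met twice, whence the factor 1/2. The diagonal terms may be taken
    relative to one index o because the corrections add up to the trace. *)
Lemma skew_traceless_planemx (X : 'M[R[i]]_N) o : X^t* = - X -> \tr X = 0 ->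
  X = (2^-1)%:C *: \sum_a \sum_b
    (if a == b then (2 * X a a) *: (delta_mx a a - delta_mx o o)
     else planemx a b (X a b)).
Proof.
move=> Xadj Xtr.
have Xconj a b : Num.conj (X a b) = - X b a.
  by move/matrixP: Xadj => /(_ b a); rewrite !mxE.
rewrite (_ : \sum_a _ = \sum_a \sum_b planemx a b (X a b) - (2 * \tr X) *: delta_mx o o).
  rewrite Xtr mulr0 scale0r subr0.
  have -> : \sum_a \sum_b planemx a b (X a b) = X + X.
    transitivity (\sum_a \sum_b X a b *: delta_mx a b
      + \sum_a \sum_b X b a *: delta_mx b a :> 'M[R[i]]_N).
      rewrite -big_split; apply: eq_bigr => a _; rewrite -big_split.
      by apply: eq_bigr => b _; rewrite /planemx Xconj scaleNr opprK.
    by rewrite [X in _ + X]exchange_big/= -matrix_sum_delta.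
  rewrite scalerDr -scalerDl -rmorphD (_ : 2^-1 + 2^-1 = 1 :> R) ?scale1r//.
  by field.
rewrite /mxtrace mulr_sumr scaler_suml -sumrB; apply: eq_bigr => a _.
rewrite (bigD1 a)//= [in RHS](bigD1 a)//= eqxx.
rewrite [RHS]addrAC; congr (_ + _).
  by rewrite /planemx Xconj scaleNr opprK -scalerDl -mulr2n mulr_natl scalerBr.
by apply: eq_bigr => b ba; rewrite eq_sym (negbTE ba).
Qed.

End PlaneRotations.

(** * The algebra of scalar functions that multiply rotations *)

Section GeneratedFunctions.
Context {R : realType} {T : Type} {N : nat}.
Context (G : (T -> 'M[R[i]]_N) -> Prop).
Hypothesis hG : unitary_group G.
Implicit Types (phi psi : T -> R[i]).

(** As [planemx] is only real-linear, c is let run over all complex numbers; this makes the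
    rotatable functions a complex vector space. *)
Definition rotatable phi := forall a b c, a != b ->
  tangent G (fun x => planemx a b (c * phi x)).

Lemma rotatableD phi psi : rotatable phi -> rotatable psi ->
  rotatable (fun x => phi x + psi x).
Proof.
move=> rphi rpsi a b c ab; apply: eq_tangent (tangentD hG (rphi a b c ab) (rpsi a b c ab)).
by move=> x; rewrite mulrDr planemxD.
Qed.

Lemma rotatableZ c phi : rotatable phi -> rotatable (fun x => c * phi x).
Proof.
move=> rphi a b c' ab; apply: eq_tangent (rphi a b (c' * c) ab) => x.
by rewrite mulrA.
Qed.

Lemma rotatable_conj phi : rotatable phi -> rotatable (fun x => Num.conj (phi x)).
Proof.
move=> rphi a b c ab; apply: (eq_tangent _ (rphi b a (- Num.conj c) _)).
  by move=> x; rewrite [RHS]planemxC rmorphM /= conjCK mulNr.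
by rewrite eq_sym.
Qed.

(** The product arises from the commutator of rotations in the planes (a, d) and (d, b), which takes
    a third index d. *)
Lemma rotatableM phi psi : (2 < N)%N -> rotatable phi -> rotatable psi ->
  rotatable (fun x => phi x * psi x).
Proof.
move=> N2 rphi rpsi a b c ab.
have [d /andP[da db]] : exists d, (d != a) && (d != b).
  apply/existsP; apply: contraT; rewrite negb_exists => /forallP ad.
  have : (#|'I_N| <= #|pred2 a b|)%N.
    apply: subset_leq_card; apply/fintype.subsetP => d _.
    by move: (ad d); rewrite negb_and !negbK !inE.
  by rewrite card_ord card2 ab leqNgt N2 //=.
have da' : a != d by rewrite eq_sym.
apply: eq_tangent (tangent_commutator hG (rphi a d c da') (rpsi d b 1 db)) => x.
by rewrite planemx_commutator// mul1r mulrA.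
Qed.

(** The available rotations link opposite sides only. Two indices on one side are linked through an
    index of the other side, the second rotation having a constant coefficient. *)
Lemma rotatable_cross (side : pred 'I_N) phi :
  (forall p, exists a, side a == p) ->
  (forall a b c, side a != side b -> tangent G (fun=> planemx a b c)) ->
  (forall a b c, side a != side b -> tangent G (fun x => planemx a b (c * phi x))) ->
  rotatable phi.
Proof.
move=> sideP t1 tphi a b c ab; case: (eqVneq (side a) (side b)) => sab; last exact: tphi.
have [d /eqP sd] := sideP (~~ side a).
have sad : side a != side d by rewrite sd; case: (side a).
have sdb : side d != side b by rewrite -sab eq_sym.
have ad : a != d by apply: contraNneq sad => ->.
have db : d != b by apply: contraNneq sdb => ->.
apply: eq_tangent (tangent_commutator hG (tphi a d c sad) (t1 d b 1 sdb)) => x.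
by rewrite planemx_commutator// mulr1.
Qed.

Lemma tangent_rotatable (f : T -> R) (X : 'M[R[i]]_N) :
  (0 < N)%N -> rotatable (fun=> 1) -> rotatable (fun x => (f x)%:C) ->
  X^t* = - X -> \tr X = 0 -> tangent G (fun x => (f x)%:C *: X).
Proof.
move=> N0 r1 rf Xadj Xtr; pose o := Ordinal N0.
have Xconj a : Num.conj (X a a) = - X a a.
  by move/matrixP: Xadj => /(_ a a); rewrite !mxE.
rewrite (skew_traceless_planemx o Xadj Xtr).
under [X in tangent _ X]eq_fun do rewrite scalerA mulrC -scalerA.
apply: tangentZ => //.
under [X in tangent _ X]eq_fun do rewrite scaler_sumr.
apply: tangent_sum => // a _.
under [X in tangent _ X]eq_fun do rewrite scaler_sumr.
apply: tangent_sum => // b _.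
case: eqP => [_|/eqP ab]; last first.
  by apply: eq_tangent (rf a b (X a b) ab) => x; rewrite mulrC planemxZ.
have [->|ao] := eqVneq a o.
  by apply: eq_tangent (tangent0 hG) => x; rewrite subrr !scaler0.
(* X a a is imaginary, so for x = - X a a * f and y = 1 the coefficient conj x * y - x * conj y is 2
   * X a a * f. *)
have := tangent_commutator hG (rf a o (- X a a) ao) (r1 a o 1 ao).
apply: eq_tangent => x; rewrite planemx_commutator_diag// scalerA; congr (_ *: _).
rewrite mulr1 rmorph1 !mulr1 rmorphM rmorphN /= Xconj opprK.
by rewrite conj_realC; ring.
Qed.

End GeneratedFunctions.

(** * The group of protocols *)

Section ComplexMeasurability.
Context {R : realType} {d : measure_display} {T : measurableType d}.
Implicit Types f g : T -> R[i].

Lemma measurable_cfun_cst (c : R[i]) : measurable_cfun (fun _ : T => c).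
Proof. by split; exact: measurable_cst. Qed.

Lemma measurable_cfunD f g : measurable_cfun f -> measurable_cfun g ->
  measurable_cfun (fun x => f x + g x).
Proof.
move=> [f1 f2] [g1 g2]; split.
  rewrite (_ : (fun x => _) = (fun x => complex.Re (f x) + complex.Re (g x))).
    exact: measurable_funD.
  by apply/funext => x; case: (f x) (g x) => a b [].
rewrite (_ : (fun x => _) = (fun x => complex.Im (f x) + complex.Im (g x))).
  exact: measurable_funD.
by apply/funext => x; case: (f x) (g x) => a b [].
Qed.

Lemma measurable_cfunM f g : measurable_cfun f -> measurable_cfun g ->
  measurable_cfun (fun x => f x * g x).
Proof.
move=> [f1 f2] [g1 g2]; split.
  rewrite (_ : (fun x => _) = (fun x => complex.Re (f x) * complex.Re (g x)
     - complex.Im (f x) * complex.Im (g x))).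
    by apply: measurable_funB; exact: measurable_funM.
  by apply/funext => x; case: (f x) (g x) => a b [].
rewrite (_ : (fun x => _) = (fun x => complex.Re (f x) * complex.Im (g x)
     + complex.Im (f x) * complex.Re (g x))).
  by apply: measurable_funD; exact: measurable_funM.
by apply/funext => x; case: (f x) (g x) => a b [].
Qed.

Lemma measurable_cfun_conj f : measurable_cfun f ->
  measurable_cfun (fun x => Num.conj (f x)).
Proof.
move=> [f1 f2]; split.
  by rewrite (_ : (fun x => _) = (fun x => complex.Re (f x)))//; apply/funext => x; case: (f x).
rewrite (_ : (fun x => _) = (fun x => - complex.Im (f x))); first exact: measurableT_comp.
by apply/funext => x; case: (f x).
Qed.

Lemma measurable_cfun_real (f : T -> R) :
  measurable_fun setT f -> measurable_cfun (fun x => (f x)%:C).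
Proof. by move=> mf; split => //=; exact: measurable_cst. Qed.

Lemma measurable_cfun_sum I (r : seq I) (P : pred I) (F : I -> T -> R[i]) :
  (forall i, measurable_cfun (F i)) ->
  measurable_cfun (fun x => \sum_(i <- r | P i) F i x).
Proof.
move=> mF; elim: r => [|i r IH].
  by under eq_fun do rewrite big_nil; exact: measurable_cfun_cst.
under eq_fun do rewrite big_cons; case: (P i) => //.
exact: measurable_cfunD.
Qed.

Lemma measurable_cfun_prod I (r : seq I) (P : pred I) (F : I -> T -> R[i]) :
  (forall i, measurable_cfun (F i)) ->
  measurable_cfun (fun x => \prod_(i <- r | P i) F i x).
Proof.
move=> mF; elim: r => [|i r IH].
  by under eq_fun do rewrite big_nil; exact: measurable_cfun_cst.
under eq_fun do rewrite big_cons; case: (P i) => //.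
exact: measurable_cfunM.
Qed.

Lemma measurable_mxfunM m n p (F : T -> 'M[R[i]]_(m, n)) (G : T -> 'M[R[i]]_(n, p)) :
  measurable_mxfun F -> measurable_mxfun G -> measurable_mxfun (fun x => F x *m G x).
Proof.
move=> mF mG i j; under eq_fun do rewrite mxE.
by apply: measurable_cfun_sum => k; exact: measurable_cfunM.
Qed.

Lemma measurable_mxfunD m n (F G : T -> 'M[R[i]]_(m, n)) :
  measurable_mxfun F -> measurable_mxfun G -> measurable_mxfun (fun x => F x + G x).
Proof.
by move=> mF mG i j; under eq_fun do rewrite mxE; exact: measurable_cfunD.
Qed.

Lemma measurable_mxfunZ m n (c : T -> R[i]) (F : T -> 'M[R[i]]_(m, n)) :
  measurable_cfun c -> measurable_mxfun F -> measurable_mxfun (fun x => c x *: F x).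
Proof.
by move=> mc mF i j; under eq_fun do rewrite mxE; exact: measurable_cfunM.
Qed.

Lemma measurable_mxfun_cst m n (A : 'M[R[i]]_(m, n)) :
  measurable_mxfun (fun _ : T => A).
Proof. by move=> i j; exact: measurable_cfun_cst. Qed.

Lemma measurable_mxfunB m n (F G : T -> 'M[R[i]]_(m, n)) :
  measurable_mxfun F -> measurable_mxfun G -> measurable_mxfun (fun x => F x - G x).
Proof.
move=> mF mG; apply: measurable_mxfunD => //.
under eq_fun do rewrite -scaleN1r.
by apply: measurable_mxfunZ => //; exact: measurable_cfun_cst.
Qed.

Lemma measurable_mxfun_adj m n (F : T -> 'M[R[i]]_(m, n)) :
  measurable_mxfun F -> measurable_mxfun (fun x => (F x)^t* ).
Proof.
by move=> mF i j; under eq_fun do rewrite !mxE; exact: measurable_cfun_conj.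
Qed.

Lemma measurable_cfun_det n (F : T -> 'M[R[i]]_n) :
  measurable_mxfun F -> measurable_cfun (fun x => \det (F x)).
Proof.
move=> mF; rewrite /determinant; apply: measurable_cfun_sum => s.
apply: measurable_cfunM; first exact: measurable_cfun_cst.
by apply: measurable_cfun_prod => i; exact: mF.
Qed.

End ComplexMeasurability.

Section Protocols.
Context {R : realType} (sq : circle R -> R[i]) (r : nat).
Local Notation T2 := (circle R * circle R)%type.

(** Asking the adjoint to be a product as well makes closure under inverses part of the definition,
    with no induction over [QSP]. *)
Definition protocol (F : T2 -> 'M[R[i]]_(2 ^ r)) : Prop :=
  [/\ QSP_product sq F, QSP_product sq (fun x => (F x)^t* ),
      forall x, F x \is unitarymx & measurable_mxfun F].

Lemma QSP_productM (F G : T2 -> 'M[R[i]]_(2 ^ r)) :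
  QSP_product sq F -> QSP_product sq G -> QSP_product sq (fun x => F x *m G x).
Proof.
move=> [l1 [P1 [h1 F1]]] [l2 [P2 [h2 G2]]].
exists (l1 + l2)%N, (fun i => match fintype.split i with inl j => P1 j | inr j => P2 j end).
split=> [i|x]; first by case: (fintype.split i).
rewrite big_split_ord/= F1 G2; congr (_ * _).
  by apply: eq_bigr => i _; rewrite (unsplitK (inl i)).
by apply: eq_bigr => i _; rewrite (unsplitK (inr i)).
Qed.

Lemma QSP_product1 : QSP_product sq (fun=> 1%:M : 'M[R[i]]_(2 ^ r)).
Proof.
by exists 0%N, (fun=> fun=> 0); split=> [[]//|x]; rewrite big_ord0.
Qed.

Lemma QSP_QSP_product (F G : T2 -> 'M[R[i]]_(2 ^ r)) :
  F =1 G -> QSP sq F -> QSP_product sq G.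
Proof.
by move=> FG hF; exists 1%N, (fun=> F); split=> // x; rewrite big_ord1 FG.
Qed.

Lemma protocol_group : unitary_group protocol.
Proof.
split.
- split; [exact: QSP_product1| |by move=> _; exact: unitarymx1|].
    by under eq_fun do rewrite trmx1 map_mx1; exact: QSP_product1.
  exact: measurable_mxfun_cst.
- move=> f g [f1 f2 f3 f4] [g1 g2 g3 g4]; split.
  + exact: QSP_productM.
  + by under eq_fun do rewrite trmx_mul map_mxM; exact: QSP_productM.
  + by move=> x; exact: unitarymxM.
  + exact: measurable_mxfunM.
- move=> f [f1 f2 f3 f4]; split => //.
  + by under eq_fun do rewrite trmxCK.
  + by move=> x; rewrite trmxC_unitary.
  + exact: measurable_mxfun_adj.
- by move=> f [].
Qed.

End Protocols.

(** * Rotations in a coordinate plane as elements of SU_alpha *)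

Section TwoLevelRotations.
Context {R : realType}.

Definition rotmx N (a b : 'I_N) (c : R) (s : R[i]) : 'M[R[i]]_N :=
  1%:M + (c%:C - 1) *: (delta_mx a a + delta_mx b b) + planemx a b s.

Lemma castmx_rotmx m N (e : m = N) (a b : 'I_m) c s :
  castmx (e, e) (rotmx a b c s) = rotmx (cast_ord e a) (cast_ord e b) c s.
Proof. by case: N / e; rewrite castmx_id !cast_ord_id. Qed.

Lemma rotmx_adj N (a b : 'I_N) c s : (rotmx a b c s)^t* = rotmx a b c (- s).
Proof.
apply/matrixP => i j; rewrite !mxE !(rmorphD, rmorphB, rmorphM, rmorphN, rmorph_nat) /=.
rewrite conj_realC !(andbC (j == _)) (eq_sym j) ?conjCK.
by ring.
Qed.

Lemma rotmx_unitary N (a b : 'I_N) c s : a != b ->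
  c ^+ 2 + normc s ^+ 2 = 1 -> rotmx a b c s \is unitarymx.
Proof.
move=> ab cs1; apply/unitarymxP; rewrite rotmx_adj /rotmx /planemx.
have cs : (c%:C) ^+ 2 + s * Num.conj s = 1.
  by rewrite -sqr_normc_Cnorm -rmorphXn -rmorphD cs1.
rewrite !(mulmxDl, mulmxDr, mul1mx, mulmx1, =^~ scalemxAl, =^~ scalemxAr,
  mulmxBl, mulmxBr, mulNmx, mulmxN).
rewrite !mul_delta_mx_cond !eqxx (eq_sym b a) (negbTE ab) !mulr1n !mulr0n.
move: cs; rewrite rmorphN /=.
move: (delta_mx a a) (delta_mx b b) (delta_mx a b) (delta_mx b a) => A B D E cs.
apply/matrixP => i j; rewrite !mxE.
transitivity ((i == j)%:R + (A i j + B i j) * ((c%:C) ^+ 2 + s * Num.conj s - 1)).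
  by ring.
by rewrite cs subrr mulr0 addr0.
Qed.

(** For indices in different halves both diagonal blocks are diagonal with entries 1 and c > 0,
    hence upper and lower triangular at once; so every alpha is allowed. *)
Lemma rotmx_SU m (i j : 'I_m) c s alpha : 0 < c -> c ^+ 2 + normc s ^+ 2 = 1 ->
  rotmx (lshift m i) (rshift m j) c s \in SU_alpha alpha.
Proof.
move=> c0 cs1; have cn0 : c%:C != 0 :> R[i] by rewrite (inj_eq (@complexI _)) gt_eqF.
have cs : (c%:C) ^+ 2 + s * Num.conj s = 1.
  by rewrite -sqr_normc_Cnorm -rmorphXn -rmorphD cs1.
pose D (k : 'I_m) (x : R[i]) := diag_mx (\row_l (if l == k then x else 1)).
have DE k x : D k x = 1%:M + (x - 1) *: delta_mx k k.
  apply/matrixP => a b; rewrite !mxE; have [->|ab] := eqVneq a b.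
    by rewrite !mulr1n andbb; case: eqP => _; rewrite ?mulr1 ?mulr0 ?addr0// addrC subrK.
  rewrite mulr0n add0r (_ : _ && _ = false) ?mulr0//.
  by apply/negP => /andP[/eqP ak /eqP bk]; rewrite ak bk eqxx in ab.
have detD k x : \det (D k x) = x.
  rewrite det_diag (bigD1 k)//= mxE eqxx big1 ?mulr1// => l lk.
  by rewrite mxE (negbTE lk).
have rotE : rotmx (lshift m i) (rshift m j) c s = block_mx (D i c%:C) (s *: delta_mx i j)
    (- Num.conj s *: delta_mx j i) (D j c%:C).
  rewrite !DE; apply/matrixP => a b; rewrite -[a]splitK -[b]splitK.
  case: (fintype.split a) => k; case: (fintype.split b) => l /=;
    rewrite ?block_mxEul ?block_mxEur ?block_mxEdl ?block_mxEdr !mxE /=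
      ?eq_lshift ?eq_rshift ?eq_lrshift ?eq_rlshift ?andbF ?mulr0n ?mulr0
      ?addr0 ?add0r ?subr0 ?oppr0 ?addr0 ?sub0r ?mulNr ?mulr0 ?add0r//.
have trigD k (b : bool) : triangular_pos b (D k c%:C).
  apply/andP; split; last first.
    apply/forallP => l; rewrite !mxE eqxx mulr1n.
    by case: eqP => _; rewrite ?ltr01// ltcR.
  have h : is_trig_mx (D k c%:C) by apply/is_diag_mx_is_trig/diag_mx_is_diag.
  by case: b => //; rewrite tr_diag_mx.
apply/and4P; split.
- by apply: rotmx_unitary => //; rewrite eq_lrshift.
- rewrite rotE.
  (* Block elimination: as c^2 + |s|^2 = 1, the Schur complement of the upper left block has the
     entry c + |s|^2 / c = c^-1 at j. *)
  have -> : block_mx (D i c%:C) (s *: delta_mx i j) (- Num.conj s *: delta_mx j i) (D j c%:C)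
    = block_mx 1%:M 0 (- Num.conj s / c%:C *: delta_mx j i) 1%:M *m
      block_mx (D i c%:C) (s *: delta_mx i j) 0 (D j (c%:C)^-1).
    rewrite mulmx_block !mul1mx !mul0mx ?mulmx0 !addr0 !DE.
    congr block_mx.
      rewrite mulmxDr mulmx1 -scalemxAl -scalemxAr mul_delta_mx scalerA -scalerDl.
      by congr (_ *: _); field.
    rewrite -scalemxAl -scalemxAr mul_delta_mx scalerA addrCA -scalerDl.
    congr (_ + _ *: _).
    have -> : - Num.conj s / c%:C * s = - (s * Num.conj s) / c%:C by ring.
    by rewrite -[s * _](addKr ((c%:C) ^+ 2)) cs; field.
  by rewrite det_mulmx det_lblock det_ublock !det1 !detD !mul1r mulfV.
- by rewrite rotE block_mxKul.
- by rewrite rotE block_mxKdr.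
Qed.

End TwoLevelRotations.

(** * Rotations and coordinate functions available to the protocols *)

Section ProtocolTangents.
Context {R : realType} (sq : circle R -> R[i]) (r : nat).
Hypothesis sq_measurable : measurable_cfun sq.
Hypothesis sqP : forall z : circle R, sq z ^+ 2 = z.
Local Notation T2 := (circle R * circle R)%type.
Local Notation N := (2 ^ r.+1)%N.
Local Notation G := (@protocol R sq r.+1).

Let hG : unitary_group G := protocol_group sq r.+1.

Definition top_half (a : 'I_N) : bool := (a < 2 ^ r)%N.

Lemma top_half_lshift i : top_half (cast_ord (addnn_expn2 r) (lshift _ i)).
Proof. by rewrite /top_half /= ltn_ord. Qed.

Lemma top_half_rshift i : top_half (cast_ord (addnn_expn2 r) (rshift _ i)) = false.
Proof. by rewrite /top_half /= ltnNge leq_addr. Qed.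

Lemma top_half_split a : if top_half a
  then exists i, a = cast_ord (addnn_expn2 r) (lshift _ i)
  else exists i, a = cast_ord (addnn_expn2 r) (rshift _ i).
Proof.
rewrite -(cast_ordKV (addnn_expn2 r) a); move: (cast_ord _ a) => b.
rewrite -[b]splitK; case: (fintype.split b) => i /=.
  by rewrite top_half_lshift; exists i.
by rewrite top_half_rshift; exists i.
Qed.

Lemma protocol_rotmx a b (c : R) (s : R[i]) : top_half a -> ~~ top_half b ->
  0 < c -> c ^+ 2 + normc s ^+ 2 = 1 -> G (fun=> rotmx a b c s).
Proof.
move=> sa sb c0 cs1.
have := top_half_split a; rewrite sa => -[i ->].
have := top_half_split b; rewrite (negbTE sb) => -[j ->].
have Q t : normc t = normc s -> QSP_product sq (fun _ : T2 =>
    rotmx (cast_ord (addnn_expn2 r) (lshift _ i)) (cast_ord (addnn_expn2 r) (rshift _ j)) c t).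
  move=> ts; apply: (@QSP_QSP_product _ _ _ (fun=> qubit_mx (rotmx (lshift _ i) (rshift _ j) c t))).
    by move=> _; exact: castmx_rotmx.
  by apply: (@QSP_const _ _ _ id); apply: rotmx_SU => //; rewrite ts.
split.
- exact: Q.
- by rewrite rotmx_adj; apply: Q; exact: normcN.
- move=> _; apply: rotmx_unitary => //.
  apply: contraTneq (top_half_lshift i) => ->; by rewrite top_half_rshift.
- exact: measurable_mxfun_cst.
Qed.

Lemma sqrt1B_near1 (u : R) : 0 <= u < 1 -> `|Num.sqrt (1 - u) - 1| <= u.
Proof.
move=> /andP[u0 u1]; have v0 : 0 <= 1 - u by lra.
have w0 : 0 <= Num.sqrt (1 - u) := sqrtr_ge0 _.
have := sqr_sqrtr v0; move: (Num.sqrt _) w0 => w w0 w2.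
have w1 : w <= 1.
  by rewrite -(@expr_le1 _ 2)// w2; lra.
rewrite ler_norml; apply/andP; split; last lra.
have : w ^+ 2 <= w by rewrite expr2 ler_piMl.
lra.
Qed.

(** The rotation with sine s = t c and cosine sqrt (1 - |s|^2) differs from 1 + t X only by the
    diagonal term, which is of order t^2. *)
Lemma tangent_planemx_top a b c : top_half a -> ~~ top_half b ->
  tangent G (fun=> planemx a b c).
Proof.
move=> sa sb; split.
  exists (nrm (planemx a b c) + 1) => [|_]; last by rewrite lerDl.
  by rewrite ltr_wpDl ?nrm_ge0.
move=> e e0; pose M := nrm (delta_mx a a + delta_mx b b : 'M[R[i]]_N) + 1.
have M0 : 0 < M by rewrite ltr_wpDl ?nrm_ge0.
pose B := normc c + 1; have B0 : 0 < B by rewrite ltr_wpDl ?normc_ge0.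
have cB : normc c <= B by rewrite lerDl.
(* The first bound forces |s| < 1, the second brings the error t^2 B^2 M down to e * t. *)
exists (Num.min B^-1 (e / (B ^+ 2 * M))).
  by rewrite lt_min invr_gt0 B0 divr_gt0// mulr_gt0// exprn_gt0.
move=> t /andP[t0]; rewrite lt_min => /andP[tB te].
pose s := t%:C * c.
have su : normc s ^+ 2 <= t ^+ 2 * B ^+ 2.
  rewrite normcM normcR gtr0_norm// exprMn ler_wpM2l ?sqr_ge0//.
  by rewrite ler_pXn2r// nnegrE ?normc_ge0// ltW.
have s1 : 0 <= normc s ^+ 2 < 1.
  rewrite sqr_ge0 /=; apply: le_lt_trans su _; rewrite -exprMn.
  by rewrite expr_lt1// ?mulr_ge0 ?ltW// -ltr_pdivlMr// div1r.
exists (fun=> rotmx a b (Num.sqrt (1 - normc s ^+ 2)) s).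
  apply: protocol_rotmx => //; first by rewrite sqrtr_gt0; lra.
  by rewrite sqr_sqrtr; lra.
move=> _; rewrite -planemxZ -/s /rotmx.
have addK3 (X Y Z : 'M[R[i]]_N) : X + Y + Z - X - Z = Y.
  by apply/matrixP => i j; rewrite !mxE; ring.
rewrite addK3.
rewrite nrmZ (_ : _ - 1 = (Num.sqrt (1 - normc s ^+ 2) - 1)%:C); last by rewrite rmorphB.
rewrite normcR; apply: (@le_trans _ _ (t ^+ 2 * B ^+ 2 * M)).
  rewrite ler_pM ?nrm_ge0// ?lerDl//.
  by apply: le_trans (sqrt1B_near1 s1) _.
rewrite [leLHS](_ : _ = t * (B ^+ 2 * M) * t); last by ring.
by rewrite ler_pM2r// -ler_pdivlMr ?ltW// mulr_gt0// exprn_gt0.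
Qed.

Lemma tangent_planemx_cross a b c : top_half a != top_half b ->
  tangent G (fun=> planemx a b c).
Proof.
case sa : (top_half a); case sb : (top_half b) => // _.
  by apply: tangent_planemx_top; rewrite ?sa ?sb.
by rewrite planemxC; apply: tangent_planemx_top; rewrite ?sa ?sb.
Qed.

Lemma top_half_onto p : exists a, top_half a == p.
Proof.
have h : (0 < 2 ^ r)%N by rewrite expn_gt0.
case: p; [exists (cast_ord (addnn_expn2 r) (lshift _ (Ordinal h)))
         |exists (cast_ord (addnn_expn2 r) (rshift _ (Ordinal h)))].
  by rewrite top_half_lshift.
by rewrite top_half_rshift.
Qed.

Lemma rotatable1 : rotatable G (fun=> 1).
Proof.
apply: (rotatable_cross hG (side := top_half)); first exact: top_half_onto.
  exact: tangent_planemx_cross.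
by move=> a b c ab; rewrite mulr1; exact: tangent_planemx_cross.
Qed.

Lemma phase_mxE (c : R[i]) :
  phase_mx r c = diag_mx (\row_a (if top_half a then c else c^-1)).
Proof.
apply/matrixP => a b; rewrite castmxE [RHS]mxE [X in X *+ _]mxE.
rewrite -[in RHS](cast_ordKV (addnn_expn2 r) a) -[in RHS](cast_ordKV (addnn_expn2 r) b).
rewrite (inj_eq (@cast_ord_inj _ _ _)).
move: (cast_ord _ a) (cast_ord _ b) => {}a {}b.
rewrite -[a]splitK -[b]splitK.
by case: (fintype.split a) => i; case: (fintype.split b) => j /=;
  rewrite ?block_mxEul ?block_mxEur ?block_mxEdl ?block_mxEdr
    ?top_half_lshift ?top_half_rshift ?eq_lshift ?eq_rshift ?eq_lrshift ?eq_rlshift !mxE.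
Qed.

(** Conjugation by the phase multiplies an entry in an upper row and a lower column by u * conj
    (u^-1) = u^2, as |u| = 1; the adjoint phase does the same for the opposite position. So z
    appears in place of its root. *)
Lemma rotatable_sqr (u : T2 -> R[i]) : (forall x, normc (u x) = 1) ->
  G (fun x => phase_mx r (u x)) -> rotatable G (fun x => u x ^+ 2).
Proof.
move=> u1 Gu.
have uJ x : (u x)^-1 = Num.conj (u x) := normc1_invE (u1 x).
have conjE (d : 'rV[R[i]]_N) (a b : 'I_N) y :
    diag_mx d *m planemx a b y *m (diag_mx d)^t* =
    planemx a b (d 0 a * y * Num.conj (d 0 b)).
  have dA (X : 'M[R[i]]_N) i j : (diag_mx d *m X *m (diag_mx d)^t* ) i j =
      d 0 i * X i j * Num.conj (d 0 j).
    rewrite tr_diag_mx map_diag_mx mul_mx_diag mxE mul_diag_mx !mxE //.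
  apply/matrixP => i j; rewrite dA !mxE.
  have [/andP[/eqP -> /eqP ->]|_] := boolP ((i == a) && (j == b)).
    have [/andP[/eqP -> _]|_] := boolP ((a == b) && (b == a)).
      by rewrite !rmorphM /= conjCK; ring.
    by rewrite /=; ring.
  have [/andP[/eqP -> /eqP ->]|_] := boolP ((i == b) && (j == a)).
    by rewrite !rmorphM /= conjCK; ring.
  by rewrite /=; ring.
apply: (rotatable_cross hG (side := top_half)); first exact: top_half_onto.
  exact: tangent_planemx_cross.
move=> a b c ab; have tab := tangent_planemx_cross c ab.
case sa : (top_half a) ab => ab; last first.
  have sb : top_half b by case: (top_half b) ab.
  have hGV : G (fun x => (phase_mx r (u x))^t* ) by case: hG => _ _ + _; apply.
  apply: eq_tangent (tangent_conj hG hGV tab) => x.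
  rewrite phase_mxE tr_diag_mx map_diag_mx conjE !mxE sa sb uJ /= !conjCK.
  by congr planemx; ring.
have sb : top_half b = false by case: (top_half b) ab.
apply: eq_tangent (tangent_conj hG Gu tab) => x.
rewrite phase_mxE conjE !mxE sa sb uJ /= conjCK.
by congr planemx; ring.
Qed.

Lemma normc_sq z : normc (sq z) = 1.
Proof.
have /eqP := circle_valP z; rewrite normr_normc -sqP => /complexI.
by rewrite expr2 normcM -expr2 => /eqP; rewrite sqrp_eq1 ?normc_ge0// => /eqP.
Qed.

Lemma protocol_phase (p : T2 -> circle R) :
  measurable_cfun (fun x => sq (p x)) ->
  QSP sq (fun x => phase_mx r (sq (p x))) ->
  QSP sq (fun x => invmx (phase_mx r (sq (p x)))) ->
  G (fun x => phase_mx r (sq (p x))).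
Proof.
move=> mp Q QV.
have sqV z : (sq z)^-1 = Num.conj (sq z) := normc1_invE (normc_sq z).
have U x : phase_mx r (sq (p x)) \is unitarymx.
  apply/unitarymxP; rewrite phase_mxE tr_diag_mx map_diag_mx mulmx_diag.
  apply/matrixP => a b; rewrite !mxE; case: eqP => [_|//]; rewrite !mulr1n.
  case: ifP => _; rewrite ?sqV /= ?conjCK ?[Num.conj _ * _]mulrC;
    by rewrite -sqr_normc_Cnorm normc_sq expr1n.
split=> //.
- exact: QSP_QSP_product Q.
- by apply: QSP_QSP_product QV => x; rewrite invmx_unitary.
- move=> a b; under eq_fun do rewrite phase_mxE !mxE.
  case: (a == b); last by under eq_fun do rewrite mulr0n; exact: measurable_cfun_cst.
  under eq_fun do rewrite mulr1n; case: (top_half a) => //.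
  under eq_fun do rewrite sqV; exact: measurable_cfun_conj.
Qed.

Lemma rotatable_fst : rotatable G (fun x => x.1 : R[i]).
Proof.
under [X in rotatable _ X]eq_fun do rewrite -sqP.
apply: rotatable_sqr => [x|]; first exact: normc_sq.
apply: protocol_phase; [|exact: QSP_z|exact: QSP_zV].
by case: sq_measurable => m1 m2; split; [apply: measurableT_comp m1 _|apply: measurableT_comp m2 _].
Qed.

Lemma rotatable_snd : rotatable G (fun x => x.2 : R[i]).
Proof.
under [X in rotatable _ X]eq_fun do rewrite -sqP.
apply: rotatable_sqr => [x|]; first exact: normc_sq.
apply: protocol_phase; [|exact: QSP_w|exact: QSP_wV].
by case: sq_measurable => m1 m2; split; [apply: measurableT_comp m1 _|apply: measurableT_comp m2 _].
Qed.

End ProtocolTangents.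

(** * Limits in measure *)

Section Reach.
Context {R : realType} {d : measure_display} {T : measurableType d}.
Context (P : probability T R) {N : nat}.
Context (G : (T -> 'M[R[i]]_N) -> Prop).
Hypothesis hG : unitary_group G.
Implicit Types (F : T -> 'M[R[i]]_N) (f : T -> R).

(** Approximation in measure by members of G. The exceptional set A is explicit, so that F need not
    be measurable. *)
Definition reach F := forall e : R, 0 < e -> exists2 g, G g & exists A : set T,
  [/\ measurable A, (P A <= e%:E)%E & forall x, ~ A x -> nrm (g x - F x) <= e].

Let K : R := N%:R * N%:R + 1.
Let K0 : 0 < K. Proof. by rewrite /K ltr_wpDl// mulr_ge0. Qed.
Let UK (U : 'M[R[i]]_N) : U \is unitarymx -> nrm U <= K.
Proof. by move=> /nrm_unitarymx /le_trans; apply; rewrite lerDl. Qed.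

Lemma probability_setU_le (A B : set T) (a b : R) : measurable A -> measurable B ->
  (P A <= a%:E)%E -> (P B <= b%:E)%E -> (P (A `|` B) <= (a + b)%:E)%E.
Proof.
move=> mA mB PA PB; apply: le_trans (measureU2 _ mA mB) _.
by rewrite EFinD; exact: leeD.
Qed.

Lemma reach_limit F : (forall e : R, 0 < e -> exists2 F', reach F' & exists A : set T,
  [/\ measurable A, (P A <= e%:E)%E & forall x, ~ A x -> nrm (F' x - F x) <= e]) ->
  reach F.
Proof.
move=> h e e0; have e20 : 0 < e / 2 by rewrite divr_gt0.
have [F' /(_ _ e20)[g Gg [A [mA PA gA]]] [B [mB PB FB]]] := h _ e20.
exists g => //; exists (A `|` B); split; first exact: measurableU.
  by rewrite (splitr e); exact: probability_setU_le.
move=> x /not_orP[nA nB]; apply: le_trans (nrm_trans _ (F' x) _) _.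
by rewrite [leRHS]splitr lerD// ?gA ?FB.
Qed.

Lemma reach_uniform F :
  (forall e : R, 0 < e -> exists2 g, G g & forall x, nrm (g x - F x) <= e) -> reach F.
Proof.
move=> h e e0; have [g Gg gF] := h _ e0; exists g => //; exists set0.
by split=> //; rewrite measure0 lee_fin ltW.
Qed.

Lemma reachM F F' : (forall x, F x \is unitarymx) ->
  reach F -> reach F' -> reach (fun x => F x *m F' x).
Proof.
move=> FU rF rF' e e0; have [_ GM _ GU] := hG.
pose a := Num.min (e / 2) (e / (2 * K)).
have a0 : 0 < a by rewrite lt_min !divr_gt0// mulr_gt0.
have [g Gg [A [mA PA gA]]] := rF _ a0; have [h Gh [B [mB PB hB]]] := rF' _ a0.
exists (fun x => g x *m h x); first exact: GM.
have ae : a <= e / 2 by rewrite ge_min lexx.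
exists (A `|` B); split; first exact: measurableU.
  rewrite (splitr e); apply: probability_setU_le => //.
    by apply: le_trans PA _; rewrite lee_fin.
  by apply: le_trans PB _; rewrite lee_fin.
move=> x /not_orP[nA nB].
rewrite (_ : _ - _ = (g x - F x) *m h x + F x *m (h x - F' x)); last first.
  by rewrite mulmxBl mulmxBr addrA subrK.
have aK : a * K <= e / 2.
  rewrite -ler_pdivlMr// -mulrA ge_min; apply/orP; right.
  by rewrite le_eqVlt; apply/orP; left; apply/eqP; field; rewrite gt_eqF.
apply: le_trans (nrmD _ _) _; rewrite [leRHS]splitr lerD//.
  apply: le_trans (nrmM _ _) _; apply: le_trans aK.
  by rewrite ler_pM ?nrm_ge0 ?gA// UK// GU.
apply: le_trans (nrmM _ _) _; apply: le_trans aK; rewrite mulrC.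
by rewrite ler_pM ?nrm_ge0 ?hB// UK.
Qed.

Lemma reach1 : reach (fun=> 1%:M).
Proof.
apply: reach_uniform => e e0; exists (fun=> 1%:M); first by case: hG.
by move=> x; rewrite subrr nrm0 ltW.
Qed.

(** Unlike tangency, which is uniform, this property passes to pointwise limits of f. The pairs (W,
    th) of zero sum describe all traceless skew-Hermitian directions. *)
Definition steerable f := measurable_fun setT f /\
  forall (W : 'M[R[i]]_N) (th : 'rV[R]_N), W \is unitarymx -> \sum_j th 0 j = 0 ->
    reach (fun x => expmx W th (f x)).

Lemma steerableD f g : steerable f -> steerable g -> steerable (fun x => f x + g x).
Proof.
move=> [mf rf] [mg rg]; split; first exact: measurable_funD.
move=> W th WU th0; under eq_fun do rewrite expmxD//.
by apply: reachM; [move=> x; exact: expmx_unitary|exact: rf|exact: rg].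
Qed.

Lemma steerableN f : steerable f -> steerable (fun x => - f x).
Proof.
move=> [mf rf]; split; first exact: measurableT_comp.
move=> W th WU th0.
rewrite (_ : (fun x => _) = (fun x => expmx W (- th) (f x))).
  by apply: rf => //; under eq_bigr do rewrite mxE; rewrite sumrN th0 oppr0.
apply/funext => x; rewrite /expmx.
suff -> : \row_j cis (th 0 j * - f x) = \row_j cis ((- th) 0 j * f x) by [].
by apply/rowP => j; rewrite !mxE mulrN mulNr.
Qed.

(** Egorov's theorem: the convergence is uniform outside a set of small probability. *)
Lemma cvg_in_measure (f : (T -> R)^nat) (g : T -> R) :
  (forall n, measurable_fun setT (f n)) -> (forall x, f ^~ x @ \oo --> g x) ->
  forall e : R, 0 < e -> exists n, exists A : set T,
    [/\ measurable A, (P A <= e%:E)%E & forall x, ~ A x -> `|f n x - g x| <= e].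
Proof.
move=> mf fg e e0.
have Pfin : (P setT < +oo)%E by rewrite probability_setT ltry.
have [B [mB PB unif]] := pointwise_almost_uniform mf measurableT Pfin (fun x _ => fg x) e0.
have [] := unif [set h | forall y, (setT `\` B) y -> `|g y - h y| < e].
  apply/uniform_nbhs; exists [set xy | `|xy.1 - xy.2| < e]; split => //.
  exact: (@entourage_ball R R (PosNum e0)).
move=> n _ /(_ n (leqnn n)) /= h; exists n, B; split=> //; first exact: ltW.
by move=> x Bx; rewrite distrC ltW// h.
Qed.

(** By [expmx_lipschitz], convergence in measure of the exponents carries over to the
    exponentials. *)
Lemma steerable_cvg (f : (T -> R)^nat) (g : T -> R) :
  (forall n, steerable (f n)) -> (forall x, f ^~ x @ \oo --> g x) -> steerable g.
Proof.
move=> sf fg; have mf n : measurable_fun setT (f n) := (sf n).1.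
split; first by apply: measurable_fun_cvg mf _ => x _; exact: fg.
move=> W th WU th0; apply: reach_limit => e e0.
have [C C0 lipC] := expmx_lipschitz th WU.
have d0 : 0 < Num.min e (e / C) by rewrite lt_min e0 divr_gt0.
have [n [A [mA PA nA]]] := cvg_in_measure mf fg d0.
exists (fun x => expmx W th (f n x)); first exact: (sf n).2.
exists A; split => //.
  by apply: le_trans PA _; rewrite lee_fin ge_min lexx.
move=> x /nA xA; apply: le_trans (lipC _ _) _.
rewrite mulrC -ler_pdivlMr//; apply: le_trans xA _.
by rewrite ge_min lexx orbT.
Qed.

Hypothesis N2 : (2 < N)%N.
Hypothesis rot1 : rotatable G (fun=> 1).

(** A real algebra, by [rotatableM]; on the torus it contains the real and imaginary parts of z and
    w. Boundedness is required by [tangent_expmx]. *)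
Definition polynomial_like f := [/\ measurable_fun setT f,
  (exists M, forall x, `|f x| <= M) & rotatable G (fun x => (f x)%:C)].

Lemma polynomial_like_steerable f : polynomial_like f -> steerable f.
Proof.
move=> [mf [M fM] rf]; split=> // W th WU th0; apply: reach_uniform.
apply: (tangent_expmx hG WU fM).
apply: (tangent_rotatable hG) => //.
- exact: ltn_trans N2.
- exact: genmx_adj.
- exact: mxtrace_genmx.
Qed.

Lemma polynomial_like_cst (c : R) : polynomial_like (fun=> c).
Proof.
split; [exact: measurable_cst|by exists (`|c|)|].
rewrite (_ : (fun _ => _) = (fun _ : T => c%:C * 1)); last first.
  by apply/funext => x; rewrite mulr1.
exact: rotatableZ.
Qed.

Lemma polynomial_likeD f g : polynomial_like f -> polynomial_like g ->
  polynomial_like (fun x => f x + g x).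
Proof.
move=> [mf [M fM] rf] [mg [M' gM] rg]; split; first exact: measurable_funD.
  by exists (M + M') => x; apply: le_trans (ler_normD _ _) _; exact: lerD.
rewrite (_ : (fun x => _) = (fun x => (f x)%:C + (g x)%:C)).
  exact: rotatableD.
by apply/funext => x; exact: rmorphD.
Qed.

Lemma polynomial_likeM f g : polynomial_like f -> polynomial_like g ->
  polynomial_like (fun x => f x * g x).
Proof.
move=> [mf [M fM] rf] [mg [M' gM] rg]; split; first exact: measurable_funM.
  by exists (M * M') => x; rewrite normrM ler_pM.
rewrite (_ : (fun x => _) = (fun x => (f x)%:C * (g x)%:C)).
  exact: rotatableM.
by apply/funext => x; exact: rmorphM.
Qed.

(* The iterates of s |-> (3 s - s^3) / 2 are polynomials in s that converge
   pointwise on [-1, 1] to the sign of s. *)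
Fixpoint sign_iter (s : R) n : R :=
  if n is m.+1 then (3 * sign_iter s m - sign_iter s m ^+ 3) / 2 else s.

Lemma sign_iterN s n : sign_iter (- s) n = - sign_iter s n.
Proof. by elim: n => //= n ->; field. Qed.

Lemma sign_iter_gt0 s : 0 < s <= 1 -> sign_iter s n @[n --> \oo] --> (1 : R).
Proof.
(* One step multiplies the error 1 - t by (1 - t) * (2 + t) / 2 <= 1 - t / 2, which is at most q as
   long as t >= s. *)
move=> /andP[s0 s1]; pose q := 1 - s / 2.
have q01 : 0 <= q < 1 by rewrite /q; apply/andP; split; lra.
have H n : s <= sign_iter s n <= 1 /\ 1 - sign_iter s n <= q ^+ n.
  elim: n => [|n [/andP[h1 h2] h3]] /=; first by rewrite lexx s1 expr0; split=> //; lra.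
  move: (sign_iter s n) h1 h2 h3 => t h1 h2 h3.
  have e1 : 1 - (3 * t - t ^+ 3) / 2 = (1 - t) * ((1 - t) * (2 + t) / 2) by field.
  have b1 : (1 - t) * (2 + t) / 2 <= q.
    have : 0 <= t ^+ 2 := sqr_ge0 _; rewrite /q => ?.
    have -> : (1 - t) * (2 + t) / 2 = 1 - t / 2 - t ^+ 2 / 2 by field.
    lra.
  have b0 : 0 <= (1 - t) * (2 + t) / 2.
    by apply: divr_ge0 => //; apply: mulr_ge0; lra.
  have t1 : 0 <= 1 - t by lra.
  have e2 : 1 - (3 * t - t ^+ 3) / 2 <= 1 - t.
    rewrite e1 ler_piMr//; apply: le_trans b1 _; lra.
  have e3 : 0 <= 1 - (3 * t - t ^+ 3) / 2 by rewrite e1 mulr_ge0.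
  split; first by apply/andP; split; lra.
  by rewrite e1 exprSr ler_pM.
have qn : q ^+ n @[n --> \oo] --> (0 : R).
  by apply: cvg_expr; rewrite ger0_norm; case/andP: q01.
apply: (@squeeze_cvgr _ _ _ _ (fun n => 1 - q ^+ n) (fun=> 1)).
- by near=> n; have [/andP[_ ->] h] := H n; rewrite andbT; lra.
- rewrite -[X in _ --> X]subr0; apply: cvgB => //; exact: cvg_cst.
- exact: cvg_cst.
Unshelve. all: by end_near. Qed.

(** The polynomial (t^2 + t) / 2 sends the three signs 1, 0, -1 to 1, 0, 0. *)
Lemma sign_iter_indic s : `|s| <= 1 ->
  (sign_iter s n ^+ 2 + sign_iter s n) / 2 @[n --> \oo] --> ((0 < s)%R%:R : R).
Proof.
move=> s1; have H l : sign_iter s n @[n --> \oo] --> (l : R) ->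
    (sign_iter s n ^+ 2 + sign_iter s n) / 2 @[n --> \oo] --> (l ^+ 2 + l) / 2.
  by move=> h; apply: cvgMl; apply: cvgD => //; rewrite expr2; apply: cvgM.
have [s0|s0|s0] := ltgtP 0 s.
- have -> : true%:R = (1 ^+ 2 + 1) / 2 :> R by rewrite -[true%:R]/(1 : R); field.
  by apply/H/sign_iter_gt0; rewrite s0 -(ger0_norm (ltW s0)).
- have -> : false%:R = ((- 1) ^+ 2 + - 1) / 2 :> R by rewrite sqrrN expr1n subrr mul0r.
  apply: H; rewrite -(opprK s); under eq_fun do rewrite sign_iterN.
  by apply: cvgN; apply: sign_iter_gt0; rewrite oppr_gt0 s0 -(ltr0_norm s0).
- have -> : false%:R = ((0 : R) ^+ 2 + 0) / 2 by rewrite expr0n addr0 mul0r.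
  apply: H; rewrite -s0 (_ : sign_iter 0 = fun=> 0); first exact: cvg_cst.
  by apply/funext; elim=> //= n ->; rewrite mulr0 expr0n subrr mul0r.
Qed.

Definition polynomial_limit (A : set T) := exists2 f : (T -> R)^nat,
  forall n, polynomial_like (f n) & forall x, f ^~ x @ \oo --> (\1_A x : R).

Lemma polynomial_limit_setI : setI_closed polynomial_limit.
Proof.
move=> A B [f pf fA] [g pg gB]; exists (fun n x => f n x * g n x).
  by move=> n; exact: polynomial_likeM.
by move=> x; rewrite indicI; exact: cvgM.
Qed.

Lemma polynomial_limit_gt f (c : R) : polynomial_like f -> polynomial_limit [set x | c < f x].
Proof.
move=> pf; have [_ [M fM] _] := pf.
(* L bounds |f x - c|, so that s takes its values in [-1, 1], where [sign_iter] converges. *)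
pose L := `|M| + `|c| + 1; have L0 : 0 < L by rewrite /L ltr_wpDl// addr_ge0.
pose s x := L^-1 * (f x - c).
have ps : polynomial_like s.
  exact: (polynomial_likeM (polynomial_like_cst _)
    (polynomial_likeD pf (polynomial_like_cst (- c)))).
have pS n : polynomial_like (fun x => sign_iter (s x) n).
  elim: n => [|n IH]; first exact: ps.
  rewrite (_ : (fun x => _) = (fun x => (3 * sign_iter (s x) n
      + -1 * (sign_iter (s x) n * (sign_iter (s x) n * sign_iter (s x) n))) * 2^-1)); last first.
    by apply/funext => x; rewrite mulN1r [LHS]/= !exprS expr0 mulr1.
  exact: (polynomial_likeM (polynomial_likeD (polynomial_likeM (polynomial_like_cst _) IH)
    (polynomial_likeM (polynomial_like_cst _) (polynomial_likeM IH (polynomial_likeM IH IH))))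
    (polynomial_like_cst _)).
exists (fun n x => (sign_iter (s x) n ^+ 2 + sign_iter (s x) n) / 2).
  move=> n; under eq_fun do rewrite expr2.
  exact: (polynomial_likeM (polynomial_likeD (polynomial_likeM (pS n) (pS n)) (pS n))
    (polynomial_like_cst _)).
move=> x; have -> : \1_[set x | c < f x] x = (0 < s x)%R%:R :> R.
  rewrite indicE /s pmulr_rgt0 ?invr_gt0// subr_gt0; congr (_%:R); congr nat_of_bool.
  by apply/idP/idP; rewrite inE.
apply: sign_iter_indic; rewrite /s normrM gtr0_norm ?invr_gt0// ler_pdivrMl// mulr1.
apply: le_trans (ler_normB _ _) _; rewrite /L -addrA lerD// ?lerDl//.
by apply: le_trans (fM x) _; exact: ler_norm.
Qed.

Lemma polynomial_limit_measurable A : polynomial_limit A -> measurable A.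
Proof.
move=> [f pf fA]; apply/measurable_indicP.
by apply: (measurable_fun_cvg (h := f)) => [n|x _]; [case: (pf n)|exact: fA].
Qed.

(* Pi-lambda: pointwise limits of polynomials form a pi-system, while the
   bounded convergence in [steerable_cvg] gives a lambda-system. *)
Lemma steerable_indic : @measurable _ T = <<s polynomial_limit >> ->
  forall A, measurable A -> steerable \1_A.
Proof.
move=> genE A; rewrite genE => mA.
have s1 : steerable (fun=> 1) by apply/polynomial_like_steerable/polynomial_like_cst.
apply: (dynkin_induction (G := polynomial_limit) (P := fun A => steerable \1_A)) mA.
- exact: genE.
- exact: polynomial_limit_setI.
- by rewrite indicT; exact: s1.
- by move=> B [f pf fB]; apply: steerable_cvg fB => n; exact: polynomial_like_steerable.
- move=> B _ sB; rewrite (_ : \1_(~` B) = (fun x => 1 + - \1_B x)); last first.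
    by apply/funext => x; rewrite !indicE in_setC; case: (x \in B); rewrite ?subrr ?subr0.
  exact: (steerableD s1 (steerableN sB)).
- move=> F mF tF sF; apply: (@steerable_cvg (fun n x => \sum_(k < n) \1_(F k) x)).
    elim=> [|n IH].
      rewrite (_ : (fun x => _) = (fun=> 0)); last by apply/funext => x; rewrite big_ord0.
      exact: polynomial_like_steerable (polynomial_like_cst 0).
    rewrite (_ : (fun x => _) = (fun x => \sum_(k < n) \1_(F k) x + \1_(F n) x)).
      exact: (steerableD IH (sF n)).
    by apply/funext => x; rewrite big_ord_recr.
  (* Disjointness makes the partial sums eventually constant: 1 from k.+1 on if x lies in F k, and 0
     throughout if x lies in no F k. *)
  move=> x; have [[k _ Fkx]|nF] := pselect ((\bigcup_k F k) x).
    rewrite indicE mem_set; last by exists k.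
    apply: cvg_near_cst; exists k.+1 => // n /= kn.
    rewrite (bigD1 (Ordinal kn))//= indicE mem_set// big1 ?addr0// => j jk.
    rewrite indicE memNset// => Fjx; move/eqP: jk; apply; apply: val_inj => /=.
    by apply: tF => //; exists x; split.
  rewrite indicE memNset// (_ : (fun n => _) = (fun=> 0)); first exact: cvg_cst.
  apply/funext => n; rewrite big1// => j _; rewrite indicE memNset// => Fjx.
  by apply: nF; exists j.
Qed.

End Reach.

(** * Generators of the sigma-algebra of the torus *)

Section TorusMeasurability.
Context {R : realType}.
Local Notation T2 := (circle R * circle R)%type.

Lemma measurable_circle_coord : measurable_fun setT (@circle_coord R).
Proof. by move=> _ B mB; rewrite setTI; exists B => //; rewrite setTI. Qed.

Lemma measurable_circle_fun d (T : measurableType d) (f : T -> circle R) :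
  measurable_fun setT (fun x => complex.Re (f x)) ->
  measurable_fun setT (fun x => complex.Im (f x)) -> measurable_fun setT f.
Proof.
move=> m1 m2 _ _ [B mB <-]; rewrite !setTI.
have mf : measurable_fun setT (fun x => circle_coord (f x)).
  exact: (measurable_fun_pair m1 m2).
by have := mf measurableT B mB; rewrite setTI.
Qed.

(** The circle carries the trace of the Borel sets of the plane, so the identity from the torus with
    the sigma-algebra generated by C is measurable as soon as its four real coordinates are. *)
Lemma torus_measurableE (C : set (set T2)) : C `<=` @measurable _ T2 ->
  (forall c : R, C [set x : T2 | c < complex.Re (circle_val x.1)]) ->
  (forall c : R, C [set x : T2 | c < complex.Im (circle_val x.1)]) ->
  (forall c : R, C [set x : T2 | c < complex.Re (circle_val x.2)]) ->
  (forall c : R, C [set x : T2 | c < complex.Im (circle_val x.2)]) ->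
  @measurable _ T2 = <<s C >>.
Proof.
move=> Cm c1 c2 c3 c4; apply/seteqP; split; last first.
  by apply: smallest_sub => //; exact: sigma_algebra_measurable.
pose T' := g_sigma_algebraType C.
have mR (f : T' -> R) : (forall c, C [set x | c < f x]) -> measurable_fun setT f.
  move=> fC; apply: (measurability _ (RGenOInfty.measurableE R)).
  move=> _ [_ [c ->] <-]; apply: sub_sigma_algebra; rewrite setTI.
  rewrite (_ : _ @^-1` _ = [set x | c < f x]); first exact: fC.
  by apply/seteqP; split => x /=; rewrite in_itv/= andbT.
have m12 : measurable_fun setT (fun x : T' => (x.1, x.2) : T2).
  by apply: measurable_fun_pair; apply: measurable_circle_fun; apply: mR.
move=> A mA; have := m12 measurableT A mA; rewrite setTI.
by rewrite (_ : _ @^-1` A = A)//; apply/seteqP; split => -[].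
Qed.

Lemma normc_circle (z : circle R) : normc z = 1.
Proof. by have /eqP := circle_valP z; rewrite normr_normc => /complexI. Qed.

End TorusMeasurability.

Section TorusSteering.
Context {R : realType} (sq : circle R -> R[i]) (r : nat).
Hypothesis sq_measurable : measurable_cfun sq.
Hypothesis sqP : forall z : circle R, sq z ^+ 2 = z.
Hypothesis r_gt0 : (0 < r)%N.
Local Notation T2 := (circle R * circle R)%type.
Local Notation N := (2 ^ r.+1)%N.
Local Notation G := (@protocol R sq r.+1).

Let hG : unitary_group G := protocol_group sq r.+1.

Lemma polynomial_like_ReIm (p : T2 -> circle R) : measurable_fun setT p ->
  rotatable G (fun x => p x : R[i]) ->
  polynomial_like G (fun x => complex.Re (p x)) /\
  polynomial_like G (fun x => complex.Im (p x)).
Proof.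
move=> mp rp; have mcp : measurable_fun setT (fun x => circle_coord (p x)).
  exact: (measurableT_comp measurable_circle_coord mp).
have rpJ := rotatable_conj rp.
split; split.
- exact: (measurableT_comp measurable_fst mcp).
- by exists 1 => x; rewrite -(normc_circle (p x)) normc_Re_le.
- have := rotatableZ 2^-1 (rotatableD hG rp rpJ).
  rewrite (_ : (fun x => _) = (fun x => (complex.Re (p x))%:C)) //.
  apply/funext => x; rewrite (_ : Num.conj _ = conjc (p x))// addcJ.
  by rewrite mulKf// pnatr_eq0.
- exact: (measurableT_comp measurable_snd mcp).
- by exists 1 => x; rewrite -(normc_circle (p x)) normc_Im_le.
- have := rotatableZ (2^-1 * - 'i%C) (rotatableD hG rp (rotatableZ (-1) rpJ)).
  rewrite (_ : (fun x => _) = (fun x => (complex.Im (p x))%:C)) //.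
  apply/funext => x; rewrite (_ : Num.conj _ = conjc (p x))// mulN1r subcJ.
  rewrite [RHS](_ : _ = (2^-1 * 2) * (complex.Im (p x))%:C * (- ('i%C * 'i%C))); last first.
    by rewrite -expr2 sqr_i opprK mulr1 mulVf ?mul1r// pnatr_eq0.
  ring.
Qed.

(** Here r > 0 matters: a single qubit leaves no third index for [rotatableM]. *)
Lemma protocol_dim_gt2 : (2 < N)%N.
Proof. by case: r r_gt0 => // k _; rewrite !expnS mulnA -[3%N]/(3 * 1)%N leq_mul// expn_gt0. Qed.

Lemma torus_steerable_indic (A : set T2) : measurable A ->
  steerable (torus_prob R) G (\1_A : T2 -> R).
Proof.
have r1 : rotatable G (fun=> 1) by exact: rotatable1.
have [p1 p2] := polynomial_like_ReIm measurable_fst (rotatable_fst (r:=r) sq_measurable sqP).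
have [p3 p4] := polynomial_like_ReIm measurable_snd (rotatable_snd (r:=r) sq_measurable sqP).
move: A; apply: (@steerable_indic _ _ _ (torus_prob R) _ _ hG protocol_dim_gt2 r1).
apply: torus_measurableE; first exact: polynomial_limit_measurable.
- by move=> c; exact: (polynomial_limit_gt hG protocol_dim_gt2 r1 c p1).
- by move=> c; exact: (polynomial_limit_gt hG protocol_dim_gt2 r1 c p2).
- by move=> c; exact: (polynomial_limit_gt hG protocol_dim_gt2 r1 c p3).
- by move=> c; exact: (polynomial_limit_gt hG protocol_dim_gt2 r1 c p4).
Qed.

End TorusSteering.

(** * Measurable functions with values in SU(N) *)

Section SpecialUnitaryValued.
Context {R : realType} {N : nat}.
Hypothesis N_gt0 : (0 < N)%N.

Definition SUmx (V : 'M[R[i]]_N) := V \is unitarymx /\ \det V = 1.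

(** As the determinant is 1, the angles of the eigenvalues sum to a multiple S of 2 pi; subtracting
    S from one of them changes no eigenvalue and makes the sum vanish. *)
Lemma SUmx_expmx (V : 'M[R[i]]_N) : SUmx V -> exists (W : 'M[R[i]]_N) (th : 'rV[R]_N),
  [/\ W \is unitarymx, \sum_j th 0 j = 0 & V = expmx W th 1].
Proof.
move=> [VU detV]; have VV := unitarymxP VU.
have nV : V \is normalmx by apply/normalmxP; rewrite VV (mulmx1C VV).
have [W [D [WU VE]]] : exists (W : 'M[R[i]]_N) (D : 'rV[R[i]]_N),
    W \is unitarymx /\ V = W^t* *m diag_mx D *m W.
  exists (spectralmx V), (spectral_diag V); split; first exact: spectral_unitarymx.
  by rewrite -(invmx_unitary (spectral_unitarymx V)); exact: orthomx_spectralP.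
have WW := unitarymxP WU.
have DE : diag_mx D = W *m V *m W^t*.
  by rewrite [X in W *m X]VE !mulmxA WW mul1mx -mulmxA WW mulmx1.
have DU : diag_mx D \is unitarymx.
  rewrite DE; apply: unitarymxM; first exact: unitarymxM.
  by rewrite trmxC_unitary.
have D1 j : normc (D 0 j) = 1.
  have /matrixP/(_ j j) := unitarymxP DU.
  rewrite tr_diag_mx map_diag_mx mulmx_diag !mxE eqxx !mulr1n -sqr_normc_Cnorm.
  by move=> /complexI /eqP; rewrite sqrp_eq1 ?normc_ge0// => /eqP.
have /choice[th thP] : forall j, exists t, cis t = D 0 j.
  by move=> j; exact: cis_onto.
have th1 : cis (\sum_j th j) = 1.
  transitivity (\prod_j D 0 j); first by rewrite cis_sum; apply: eq_bigr.
  have := det_diag D; rewrite DE !det_mulmx mulrAC -det_mulmx WW det1 mul1r detV.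
  by move=> <-.
pose o := Ordinal N_gt0; pose S := \sum_j th j.
exists W, (\row_j (if j == o then th j - S else th j)); split; first exact: WU.
  under eq_bigr do rewrite mxE.
  rewrite (bigD1 o)//= ?eqxx (eq_bigr th); last by move=> j /negbTE ->.
  rewrite addrAC; apply/eqP; rewrite subr_eq0; apply/eqP.
  by rewrite /S [RHS](bigD1 o).
rewrite [LHS]VE /expmx.
suff -> : D = \row_j cis ((\row_j (if j == o then th j - S else th j)) 0 j * 1) by [].
apply/rowP => j; rewrite !mxE mulr1; case: ifP => _; rewrite -?thP//.
by rewrite cisD cisN th1 rmorph1 mulr1.
Qed.

Context {d : measure_display} {T : measurableType d} (P : probability T R).
Context (G : (T -> 'M[R[i]]_N) -> Prop).
Hypothesis hG : unitary_group G.
Hypothesis steer : forall A : set T, measurable A -> steerable P G (\1_A : T -> R).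

Lemma reach_indic V (A : set T) : SUmx V -> measurable A ->
  exists2 F : T -> 'M[R[i]]_N, reach P G F &
    [/\ forall x, F x \is unitarymx, forall x, A x -> F x = V & forall x, ~ A x -> F x = 1%:M].
Proof.
move=> /SUmx_expmx[W [th [WU th0 ->]]] mA.
exists (fun x => expmx W th (\1_A x)); first by have [_] := steer mA; apply.
split=> [x|x Ax|x Ax]; first exact: expmx_unitary.
  by rewrite indicE mem_set.
by rewrite indicE memNset// expmx0.
Qed.

Lemma reach_simple (I : finType) (code : T -> I) (V : I -> 'M[R[i]]_N) :
  (forall c, SUmx (V c)) -> (forall c, measurable [set x | code x = c]) ->
  reach P G (fun x => V (code x)).
Proof.
move=> VSU mcode.
(* The functions of [reach_indic] are multiplied over the codes; at each point only the factor of
   its own code can differ from 1. *)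
have H (s : seq I) : uniq s -> exists2 F, reach P G F &
    [/\ forall x, F x \is unitarymx, forall x, code x \in s -> F x = V (code x) &
      forall x, code x \notin s -> F x = 1%:M].
  elim: s => [_|c s IH /= /andP[cs us]].
    exists (fun=> 1%:M); first exact: reach1.
    by split => // x; exact: unitarymx1.
  have [F rF [FU F1 F2]] := IH us.
  have [E rE [EU E1 E2]] := reach_indic (VSU c) (mcode c).
  exists (fun x => E x *m F x); first exact: reachM.
  split=> x; first exact: unitarymxM.
    rewrite inE; have [xc _|xc /=] := eqVneq (code x) c.
      by rewrite E1// F2 ?mulmx1 -?xc// xc.
    by move=> xs; rewrite E2 ?mul1mx ?F1//; apply/eqP.
  rewrite inE negb_or => /andP[/eqP xc xs].
  by rewrite E2// F2// mulmx1.
have [F rF [_ F1 _]] := H _ (enum_uniq I).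
rewrite (_ : (fun x => _) = F)//; apply/funext => x.
by rewrite F1// mem_enum.
Qed.

Definition cpart (b : bool) (z : R[i]) : R := if b then complex.Re z else complex.Im z.

(** Rounding of all real and imaginary parts to mesh 1 / k in [-1, 1], encoded by the answers to
    threshold tests: codes form a finite type, and each fibre is a finite intersection of measurable
    sets. *)
Definition grid_code k (M : 'M[R[i]]_N) :
    {ffun 'I_N * 'I_N * bool * 'I_((2 * k).+1) -> bool} :=
  [ffun p => (nat_of_ord p.2)%:R <= (cpart p.1.2 (M p.1.1.1 p.1.1.2) + 1) * k%:R].

Lemma grid_close k (y y' : R) : (0 < k)%N -> `|y| <= 1 -> `|y'| <= 1 ->
  (forall l : 'I_((2 * k).+1), (nat_of_ord l)%:R <= (y + 1) * k%:R =
     ((nat_of_ord l)%:R <= (y' + 1) * k%:R) :> bool) ->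
  `|y - y'| <= k%:R^-1.
Proof.
move=> k0; have kR : 0 < k%:R :> R by rewrite ltr0n.
wlog yy : y y' / y <= y'.
  move=> W hy hy' h; have [yy|yy] := leP y y'; first exact: W.
  by rewrite distrC; apply: W => //; exact: ltW.
rewrite (ler_norml y) (ler_norml y') => /andP[y1 y2] /andP[y1' y2'] h.
rewrite distrC ger0_norm ?subr_ge0// leNgt; apply/negP => lt1.
have y0 : 0 <= (y + 1) * k%:R by rewrite mulr_ge0//; lra.
(* The first integer above (y + 1) * k. A gap larger than 1 / k puts it below (y' + 1) * k <= 2 * k,
   so it is one of the thresholds and separates y from y'. *)
pose l := (Num.truncn ((y + 1) * k%:R)).+1.
have l1 : (y + 1) * k%:R < l%:R by rewrite truncnS_gt.
have l2 : l%:R <= (y' + 1) * k%:R.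
  rewrite /l -natr1; have : (Num.truncn ((y + 1) * k%:R))%:R <= (y + 1) * k%:R :> R.
    by rewrite truncn_le.
  move: lt1; rewrite -[_^-1]mul1r ltr_pdivrMr// => lt1; lra.
have l3 : (l < (2 * k).+1)%N.
  rewrite ltnS -(ler_nat R) natrM; apply: le_trans l2 _.
  by rewrite ler_pM2r//; lra.
by have := h (Ordinal l3); rewrite /= l2 leNgt l1.
Qed.

Lemma grid_code_close k (U V : 'M[R[i]]_N) : (0 < k)%N ->
  U \is unitarymx -> V \is unitarymx -> grid_code k U = grid_code k V ->
  nrm (U - V) <= N%:R * N%:R * (2 * k%:R^-1).
Proof.
move=> k0 UU VU UV; apply: nrm_le => i j; rewrite !mxE.
have cl b : `|cpart b (U i j) - cpart b (V i j)| <= k%:R^-1.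
  have c1 (W : 'M[R[i]]_N) : W \is unitarymx -> `|cpart b (W i j)| <= 1.
    move=> WU; apply: le_trans (unitarymx_entry_le i j WU); case: b => /=.
      exact: normc_Re_le.
    exact: normc_Im_le.
  apply: grid_close => //; [exact: c1|exact: c1|] => l.
  by move/ffunP: UV => /(_ (i, j, b, l)); rewrite !ffunE.
apply: le_trans (normc_le_ReIm _) _; have := cl true; have := cl false; rewrite /cpart.
by case: (U i j) (V i j) => a b [a' b'] /=; lra.
Qed.

Lemma measurable_grid_code k (Q : T -> 'M[R[i]]_N) c : measurable_mxfun Q ->
  measurable [set x | grid_code k (Q x) = c].
Proof.
move=> mQ; pose E p := [set x | ((nat_of_ord p.2)%:R <=
  (cpart p.1.2 (Q x p.1.1.1 p.1.1.2) + 1) * k%:R :> R) = c p].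
rewrite (_ : [set x | _] = \bigcap_(p in setT) E p).
  apply: fin_bigcap_measurable => [|p _]; first exact: finite_finset.
  have mf : measurable_fun setT (fun x => (cpart p.1.2 (Q x p.1.1.1 p.1.1.2) + 1) * k%:R).
    apply: measurable_funM => //; apply: measurable_funD => //.
    by rewrite /cpart; case: (p.1.2); case: (mQ p.1.1.1 p.1.1.2).
  have mE : measurable_fun setT (fun x => (nat_of_ord p.2)%:R <=
      (cpart p.1.2 (Q x p.1.1.1 p.1.1.2) + 1) * k%:R :> R).
    exact: measurable_fun_ler.
  by have := mE measurableT [set c p] I; rewrite setTI.
apply/seteqP; split=> [x /= xc p _|x h]; first by rewrite /E /= -xc ffunE.
by apply/ffunP => p; rewrite ffunE; exact: h.
Qed.

Lemma reach_SUmx (Q : T -> 'M[R[i]]_N) : measurable_mxfun Q ->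
  (forall x, SUmx (Q x)) -> reach P G Q.
Proof.
move=> mQ QSU; apply: reach_limit => e e0.
pose C : R := N%:R * N%:R * 2 + 1.
have C0 : 0 < C by rewrite ltr_wpDl// !mulr_ge0.
have eC : 0 < e / C by rewrite divr_gt0.
have [n nE] : exists n, (n.+1%:R : R)^-1 < e / C.
  by have [n _ /(_ n (leqnn n)) nd] := near_infty_natSinv_lt (PosNum eC); exists n.
(* The representative of a cell is chosen inside SU(N), not on the grid, so that [reach_simple]
   applies; the default 1 is for cells that SU(N) does not meet. *)
pose V c := if pselect (exists U, SUmx U /\ grid_code n.+1 U = c) is left h
            then projT1 (cid h) else 1%:M.
exists (fun x => V (grid_code n.+1 (Q x))).
  apply: (@reach_simple _ (fun x => grid_code n.+1 (Q x))).
    move=> c; rewrite /V; case: pselect => [h|_]; first by case: (projT2 (cid h)).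
    by split; [exact: unitarymx1|exact: det1].
  by move=> c; exact: measurable_grid_code.
exists set0; split=> //; first by rewrite measure0 lee_fin ltW.
move=> x _; rewrite /V; case: pselect => [h|[]]; last by exists (Q x).
have [[VU _] VQ] := projT2 (cid h).
apply: le_trans (grid_code_close (ltn0Sn n) VU (QSU x).1 VQ) _.
rewrite mulrA; apply: (@le_trans _ _ (C * (e / C))).
  by rewrite ler_pM ?mulr_ge0 ?invr_ge0// ?lerDl// ltW.
by rewrite mulrC divfK// gt_eqF.
Qed.

End SpecialUnitaryValued.

(** * Unitary dilations of strict contractions *)

Section StrictContractions.
Context {R : realType}.

Lemma mxnorm2Z m n c (A : 'M[R[i]]_(m, n)) : mxnorm2 (c *: A) = normc c * mxnorm2 A.
Proof.
rewrite /mxnorm2 -[X in X * _]ger0_norm ?normc_ge0// -sqrtr_sqr -sqrtrM ?sqr_ge0//.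
congr Num.sqrt; rewrite mulr_sumr; apply: eq_bigr => i _; rewrite mulr_sumr.
by apply: eq_bigr => j _; rewrite mxE normcM exprMn.
Qed.

Lemma normc_le_mxnorm2 m n (A : 'M[R[i]]_(m, n)) i j : normc (A i j) <= mxnorm2 A.
Proof.
rewrite -(@ler_pXn2r _ 2)// ?nnegrE ?normc_ge0 ?mxnorm2_ge0// sqr_mxnorm2.
rewrite (bigD1 i)//= (bigD1 j)//= -addrA lerDl addr_ge0//.
  by apply: sumr_ge0 => k _; exact: sqr_ge0.
by apply: sumr_ge0 => k _; apply: sumr_ge0 => l _; exact: sqr_ge0.
Qed.

Lemma mxnorm2_gt0 m n (A : 'M[R[i]]_(m, n)) : A != 0 -> 0 < mxnorm2 A.
Proof.
rewrite lt_def mxnorm2_ge0 andbT; apply: contra_neq => A0.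
apply/matrixP => i j; rewrite mxE; apply: eq0_normc; apply/eqP.
by rewrite eq_le normc_ge0 andbT -A0 normc_le_mxnorm2.
Qed.

(** In this vectorwise form, stability under products and the bound on the eigenvalues of B^* B are
    immediate. *)
Definition strict_contraction n (A : 'M[R[i]]_n) :=
  forall v : 'cV[R[i]]_n, v != 0 -> mxnorm2 (A *m v) < mxnorm2 v.

Lemma mxnorm2_mul_le_opnorm n (A : 'M[R[i]]_n) (v : 'cV[R[i]]_n) :
  mxnorm2 v <= 1 -> mxnorm2 (A *m v) <= opnorm A.
Proof.
move=> v1; apply: ub_le_sup; last by exists v.
(* The set of values must be bounded above for [sup] to dominate it. *)
exists (nrm A * (n%:R * 1%:R * 1)) => _ [u u1 <-].
apply: le_trans (mxnorm2_le_nrm _) _; apply: le_trans (nrmM _ _) _.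
rewrite ler_wpM2l ?nrm_ge0//; apply: nrm_le => i j.
by apply: le_trans u1; exact: normc_le_mxnorm2.
Qed.

Lemma opnorm_lt1_strict n (A : 'M[R[i]]_n) : opnorm A < 1 -> strict_contraction A.
Proof.
move=> A1 v v0; have m0 := mxnorm2_gt0 v0.
have := @mxnorm2_mul_le_opnorm _ A ((mxnorm2 v)^-1%:C *: v).
rewrite -scalemxAr !mxnorm2Z normcR ger0_norm ?invr_ge0 ?mxnorm2_ge0// mulVf ?gt_eqF//.
move=> /(_ (lexx _)) h; have := le_lt_trans h A1.
by rewrite ltr_pdivrMl// mulr1.
Qed.

Lemma strict_contractionM n (A B : 'M[R[i]]_n) :
  strict_contraction A -> strict_contraction B -> strict_contraction (A *m B).
Proof.
move=> hA hB v v0; rewrite -mulmxA; have [->|Bv] := eqVneq (B *m v) 0.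
  by rewrite mulmx0; have := mxnorm2_gt0 v0; rewrite -(scale0r v) mxnorm2Z normc0 mul0r.
exact: lt_trans (hA _ Bv) (hB _ v0).
Qed.

Lemma strict_contraction0 n : strict_contraction (0 : 'M[R[i]]_n).
Proof.
by move=> v v0; rewrite mul0mx -(scale0r v) mxnorm2Z normc0 mul0r mxnorm2_gt0.
Qed.

(** The adjoints c_j of the rows of W form an orthonormal eigenbasis, and the eigenvalue at c_j is
    |B c_j|^2 < |c_j|^2 = 1. *)
Lemma strict_contraction_spectral n (B : 'M[R[i]]_n) : strict_contraction B ->
  exists (W : 'M[R[i]]_n) (l : 'rV[R]_n), [/\ W \is unitarymx,
    forall j, 0 <= l 0 j < 1 &
    B^t* *m B = W^t* *m diag_mx (\row_j (l 0 j)%:C) *m W].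
Proof.
move=> hB; set A := B^t* *m B.
have nA : A \is normalmx.
  apply/normalmxP; suff -> : A^t* = A by exact: erefl.
  by rewrite /A trmx_mul map_mxM /= trmxCK.
have [W [D [WU AE]]] : exists (W : 'M[R[i]]_n) (D : 'rV[R[i]]_n),
    W \is unitarymx /\ A = W^t* *m diag_mx D *m W.
  exists (spectralmx A), (spectral_diag A); split; first exact: spectral_unitarymx.
  by rewrite -(invmx_unitary (spectral_unitarymx A)); exact: orthomx_spectralP.
have WW := unitarymxP WU.
pose c j := (row j W)^t*.
have DE j : D 0 j = (mxnorm2 (B *m c j) ^+ 2)%:C.
  have : diag_mx D = W *m A *m W^t* by rewrite AE !mulmxA WW mul1mx -mulmxA WW mulmx1.
  move/matrixP => /(_ j j); rewrite mxE eqxx mulr1n => ->.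
  rewrite sqr_mxnorm2_cV trmx_mul map_mxM /= /c trmxCK.
  rewrite !mulmxA -(mulmxA (row j W)) -/A -row_mul.
  rewrite [RHS]mxE [LHS]mxE; apply: eq_bigr => k _.
  by rewrite -(mulmxA W) -/A !mxE.
have c1 j : mxnorm2 (c j) = 1.
  have e : mxnorm2 (c j) ^+ 2 = 1.
    apply: complexI; rewrite sqr_mxnorm2_cV /c trmxCK.
    move/matrixP: WW => /(_ j j); rewrite !mxE eqxx => h; transitivity (1 : R[i]) => //.
    by rewrite -[RHS]h; apply: eq_bigr => k _; rewrite !mxE.
  by apply/eqP; rewrite -sqrp_eq1 ?mxnorm2_ge0//; apply/eqP.
exists W, (\row_j (mxnorm2 (B *m c j) ^+ 2)); split; first exact: WU.
  move=> j; rewrite mxE sqr_ge0 /= expr_lt1 ?mxnorm2_ge0// -(c1 j); apply: hB.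
  apply: contra_eq_neq (c1 j) => ->.
  by rewrite -(scale0r (0 : 'cV_n)) mxnorm2Z normc0 mul0r eq_sym oner_eq0.
rewrite AE.
suff -> : D = \row_j (((\row_j (mxnorm2 (B *m c j) ^+ 2)) 0 j)%:C) by exact: erefl.
by apply/rowP => j; rewrite !mxE DE.
Qed.

(* The fixed point of s = (l + s^2) / 2 in [0, 1] is 1 - sqrt (1 - l). Applied to
   the eigenvalues of B^* B, the iterates are polynomials in the entries of B
   and B^*, which makes the square root of 1 - B^* B measurable. *)
Fixpoint sqrt_iter (l : R) k : R :=
  if k is k'.+1 then (l + sqrt_iter l k' ^+ 2) / 2 else 0.

Lemma sqrt_iter_cvg l : 0 <= l < 1 ->
  sqrt_iter l k @[k --> \oo] --> 1 - Num.sqrt (1 - l).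
Proof.
move=> /andP[l0 l1]; have l10 : 0 < 1 - l by lra.
have r0 : 0 < Num.sqrt (1 - l) by rewrite sqrtr_gt0.
have := sqr_sqrtr (ltW l10); move: (Num.sqrt _) r0 => r r0 r2.
have r1 : r <= 1 by rewrite -(@expr_le1 _ 2) ?(ltW r0)// r2; lra.
pose s := 1 - r.
(* With s = 1 - r one has l = 2 s - s^2, so each step multiplies the error s - t by (s + t) / 2 <=
   s, and s < 1. *)
have H k : 0 <= sqrt_iter l k <= s /\ s - sqrt_iter l k <= s ^+ k.
  elim: k => [|k [/andP[h1 h2] h3]] /=.
    by rewrite lexx expr0 /s; split; [apply/andP; split => //; lra|lra].
  move: (sqrt_iter l k) h1 h2 h3 => t h1 h2 h3.
  have e : s - (l + t ^+ 2) / 2 = (s - t) * ((s + t) / 2).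
    have -> : l = 1 - r ^+ 2 by rewrite r2; ring.
    by rewrite /s; field.
  have t2 : 0 <= t ^+ 2 := sqr_ge0 _.
  have st : 0 <= (s + t) / 2 by lra.
  have st' : (s + t) / 2 <= s by lra.
  have st0 : 0 <= s - t by lra.
  have e0 : 0 <= s - (l + t ^+ 2) / 2 by rewrite e mulr_ge0.
  split; first by apply/andP; split; lra.
  by rewrite e exprSr ler_pM.
have qn : s ^+ k @[k --> \oo] --> (0 : R).
  by apply: cvg_expr; rewrite ger0_norm /s; lra.
apply: (@squeeze_cvgr _ _ _ _ (fun k => s - s ^+ k) (fun=> s)).
- by near=> k; have [/andP[_ ->] h] := H k; rewrite andbT; lra.
- rewrite -[X in _ --> X]subr0; apply: cvgB => //; exact: cvg_cst.
- exact: cvg_cst.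
Unshelve. all: by end_near. Qed.

End StrictContractions.

(** * Measurable square roots and the dilation *)

Section MeasurableDilation.
Context {R : realType} {d : measure_display} {T : measurableType d}.

Fixpoint sqrtmx_iter n (A : 'M[R[i]]_n) k : 'M[R[i]]_n :=
  if k is k'.+1 then (2^-1)%:C *: (A + sqrtmx_iter A k' *m sqrtmx_iter A k') else 0.

Lemma cvgr_sum I (r : seq I) (f : I -> nat -> R) (l : I -> R) :
  (forall i, f i k @[k --> \oo] --> l i) ->
  (\sum_(i <- r) f i k) @[k --> \oo] --> \sum_(i <- r) l i.
Proof. by move=> fl; apply: cvg_big => [|i _]; [exact: add_continuous|exact: fl]. Qed.

Lemma diag_conjM n (W : 'M[R[i]]_n) (u v : 'rV[R[i]]_n) : W \is unitarymx ->
  (W^t* *m diag_mx u *m W) *m (W^t* *m diag_mx v *m W) =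
  W^t* *m diag_mx (\row_j (u 0 j * v 0 j)) *m W.
Proof.
move=> /unitarymxP WW; rewrite !mulmxA -(mulmxA _ W) WW mulmx1.
by rewrite -(mulmxA (W^t* )) mulmx_diag.
Qed.

Lemma sqrtmx_iter_spectral n (W : 'M[R[i]]_n) (l : 'rV[R]_n) k : W \is unitarymx ->
  sqrtmx_iter (W^t* *m diag_mx (\row_j (l 0 j)%:C) *m W) k =
  W^t* *m diag_mx (\row_j (sqrt_iter (l 0 j) k)%:C) *m W.
Proof.
move=> WU; elim: k => [|k IH] /=.
  rewrite (_ : diag_mx _ = 0) ?mulmx0 ?mul0mx//.
  by apply/matrixP => i j; rewrite !mxE mul0rn.
rewrite IH (diag_conjM _ _ WU) -mulmxDl -mulmxDr scalemxAl scalemxAr.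
suff -> : (2^-1)%:C *: (diag_mx (\row_j (l 0 j)%:C)
    + diag_mx (\row_j ((\row_j (sqrt_iter (l 0 j) k)%:C) 0 j *
        (\row_j (sqrt_iter (l 0 j) k)%:C) 0 j)))
  = diag_mx (\row_j (sqrt_iter (l 0 j) k.+1)%:C) by exact: erefl.
apply/matrixP => i j; rewrite !mxE /=; case: eqP => _; rewrite ?mulr1n ?mulr0n ?addr0 ?mulr0//.
by rewrite expr2 -rmorphM -rmorphD -rmorphM mulrC.
Qed.

(** The diagonalisation is chosen point by point, with no measurability in x. It only proves
    convergence; H is measurable as a limit of measurable iterates. *)
Lemma measurable_defect n (B : T -> 'M[R[i]]_n) : measurable_mxfun B ->
  (forall x, strict_contraction (B x)) ->
  exists2 H : T -> 'M[R[i]]_n, measurable_mxfun H &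
    forall x, (H x)^t* *m H x = 1%:M - (B x)^t* *m B x.
Proof.
move=> mB hB; pose S k x := sqrtmx_iter ((B x)^t* *m B x) k.
have mS k : measurable_mxfun (S k).
  elim: k => [|k IH]; first exact: measurable_mxfun_cst.
  apply: measurable_mxfunZ; first exact: measurable_cfun_cst.
  apply: measurable_mxfunD; last exact: measurable_mxfunM.
  by apply: measurable_mxfunM => //; exact: measurable_mxfun_adj.
have cvS x : exists Z : 'M[R[i]]_n,
    (1%:M - Z)^t* *m (1%:M - Z) = 1%:M - (B x)^t* *m B x /\
    forall a b, complex.Re (S k x a b) @[k --> \oo] --> complex.Re (Z a b) /\
      complex.Im (S k x a b) @[k --> \oo] --> complex.Im (Z a b).
  have [W [l [WU l01 BE]]] := strict_contraction_spectral (hB x).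
  have idE : 1%:M = W^t* *m 1%:M *m W by rewrite mulmx1 (mulmx1C (unitarymxP WU)).
  pose D (f : R -> R) := W^t* *m diag_mx (\row_j (f (l 0 j))%:C) *m W.
  have DE f a b : D f a b = \sum_j (f (l 0 j))%:C * ((W^t* ) a j * W j b).
    rewrite /D mul_mx_diag mxE; apply: eq_bigr => j _.
    by rewrite !mxE; ring.
  have ReM (r : R) (z : R[i]) : complex.Re (r%:C * z) = r * complex.Re z.
    by case: z => u v /=; rewrite mul0r subr0.
  have ImM (r : R) (z : R[i]) : complex.Im (r%:C * z) = r * complex.Im z.
    by case: z => u v /=; rewrite mul0r addr0.
  have SE k : S k x = D (sqrt_iter ^~ k) by rewrite /S BE sqrtmx_iter_spectral.
  have cvl j : sqrt_iter (l 0 j) k @[k --> \oo] --> 1 - Num.sqrt (1 - l 0 j).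
    exact: sqrt_iter_cvg.
  exists (D (fun t => 1 - Num.sqrt (1 - t))); split.
    have -> : 1%:M - D (fun t => 1 - Num.sqrt (1 - t)) = D (fun t => Num.sqrt (1 - t)).
      rewrite idE /D -mulmxBl -mulmxBr.
      suff -> : 1%:M - diag_mx (\row_j (1 - Num.sqrt (1 - l 0 j))%:C) =
        diag_mx (\row_j (Num.sqrt (1 - l 0 j))%:C) by exact: erefl.
      apply/matrixP => i j; rewrite !mxE; case: eqP => _; rewrite ?mulr1n ?mulr0n ?subr0//.
      by rewrite rmorphB rmorph1 opprB addrC subrK.
    rewrite [X in X *m _ = _](_ : _ = D (fun t => Num.sqrt (1 - t))); last first.
      rewrite /D !trmx_mul !map_mxM /= trmxCK tr_diag_mx map_diag_mx mulmxA.
      suff -> : map_mx Num.conj (\row_j (Num.sqrt (1 - l 0 j))%:C) =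
        \row_j (Num.sqrt (1 - l 0 j))%:C :> 'rV[R[i]]_n by exact: erefl.
      by apply/rowP => j; rewrite !mxE conj_realC.
    rewrite BE /D (diag_conjM _ _ WU) idE -mulmxBl -mulmxBr.
    suff -> : diag_mx (\row_j ((\row_j (Num.sqrt (1 - l 0 j))%:C) 0 j *
       (\row_j (Num.sqrt (1 - l 0 j))%:C) 0 j)) =
        1%:M - diag_mx (\row_j (l 0 j)%:C) :> 'M[R[i]]_n by exact: erefl.
    apply/matrixP => i j; rewrite !mxE; case: eqP => _; rewrite ?mulr1n ?mulr0n ?subr0//.
    rewrite -rmorphM -expr2 sqr_sqrtr ?rmorphB ?rmorph1//.
    by rewrite subr_ge0 ltW//; case/andP: (l01 i).
  move=> a b; split.
    under eq_fun do rewrite SE DE (raddf_sum (@complex.Re R : Rcomplex R -> R)).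
    rewrite DE (raddf_sum (@complex.Re R : Rcomplex R -> R)).
    apply: cvgr_sum => j; rewrite /= ReM; under eq_fun do rewrite ReM.
    by apply: cvgMl.
  under eq_fun do rewrite SE DE (raddf_sum (@complex.Im R : Rcomplex R -> R)).
  rewrite DE (raddf_sum (@complex.Im R : Rcomplex R -> R)).
  apply: cvgr_sum => j; rewrite /= ImM; under eq_fun do rewrite ImM.
  by apply: cvgMl.
have /choice[Z ZP] := cvS.
exists (fun x => 1%:M - Z x); last by move=> x; have [] := ZP x.
apply: measurable_mxfunB; first exact: measurable_mxfun_cst.
move=> a b; split.
  apply: (measurable_fun_cvg (h := fun k x => complex.Re (S k x a b))) => [k|x _].
    by have [] := mS k a b.
  by have [_ /(_ a b)[]] := ZP x.
apply: (measurable_fun_cvg (h := fun k x => complex.Im (S k x a b))) => [k|x _].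
  by have [] := mS k a b.
by have [_ /(_ a b)[]] := ZP x.
Qed.

(** U exchanges the second summand with the range of V and fixes the orthogonal complement of that
    range, so it is a self-adjoint involution. *)
Lemma isometry_completion p n (V : 'M[R[i]]_(p, n)) : V^t* *m V = 1%:M ->
  let U := block_mx (1%:M - V *m V^t* ) V (V^t* ) 0 in U^t* = U /\ U *m U = 1%:M.
Proof.
move=> VV U; split.
  rewrite /U tr_block_mx map_block_mx trmxCK trmx0 map_mx0; congr block_mx.
  by rewrite linearB/= map_mxB trmx1 map_mx1 trmx_mul map_mxM /= trmxCK.
rewrite /U mulmx_block !mulmx0 !mul0mx !addr0 VV.
rewrite scalar_mx_block; congr block_mx.
- rewrite mulmxBl !mulmxBr !mul1mx mulmx1 mulmxA -(mulmxA V) VV mulmx1.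
  by rewrite subrr subr0 subrK.
- by rewrite mulmxBl mul1mx -mulmxA VV mulmx1 subrr.
- by rewrite mulmxBr mulmx1 mulmxA VV mul1mx subrr.
Qed.

Lemma measurable_dilation n N (e : (n + (n + n) + n = N)%N) (B : T -> 'M[R[i]]_n) :
  (0 < n)%N -> measurable_mxfun B -> (forall x, strict_contraction (B x)) ->
  exists Q : T -> 'M[R[i]]_N, [/\ measurable_mxfun Q, forall x, SUmx (Q x) &
    forall x (i j : 'I_n) (a b : 'I_N), a = i :> nat -> b = (n + (n + n) + j)%N :> nat ->
      Q x a b = B x i j].
Proof.
case: N / e => n0 mB hB.
have [H mH HE] := measurable_defect mB hB.
(* H makes V an isometry with B on top; the zero block pads it to height 3 n, so that the completion
   has size 4 n. *)
pose V x : 'M[R[i]]_(n + (n + n), n) := col_mx (B x) (col_mx (H x) 0).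
have VV x : (V x)^t* *m V x = 1%:M.
  rewrite /V !tr_col_mx !map_row_mx !mul_row_col trmx0 map_mx0 mul0mx addr0 HE.
  by rewrite addrC subrK.
pose U x := block_mx (1%:M - V x *m (V x)^t* ) (V x) ((V x)^t* ) 0.
have UJ x : (U x)^t* = U x by have [] := isometry_completion (VV x).
have UU x : U x *m U x = 1%:M by have [] := isometry_completion (VV x).
have UU' x : U x \is unitarymx by apply/unitarymxP; rewrite UJ.
have mV : measurable_mxfun V.
  move=> i j; rewrite -(splitK i); case: (fintype.split i) => k /=.
    by under eq_fun do rewrite /V col_mxEu; exact: mB.
  rewrite -[k]splitK; case: (fintype.split k) => l /=.
    by under eq_fun do rewrite /V col_mxEd col_mxEu; exact: mH.
  by under eq_fun do rewrite /V col_mxEd col_mxEd mxE; exact: measurable_cfun_cst.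
have mU : measurable_mxfun U.
  move=> i j; rewrite -(splitK i); rewrite -(splitK j).
  case: (fintype.split i) => k; case: (fintype.split j) => l /=.
  - under eq_fun do rewrite /U block_mxEul.
    apply: measurable_mxfunB; first exact: measurable_mxfun_cst.
    by apply: measurable_mxfunM => //; exact: measurable_mxfun_adj.
  - by under eq_fun do rewrite /U block_mxEur; exact: mV.
  - by under eq_fun do rewrite /U block_mxEdl; exact: measurable_mxfun_adj.
  - by under eq_fun do rewrite /U block_mxEdr mxE; exact: measurable_cfun_cst.
(* The involution U has determinant 1 or -1. Rescaling the column o by it gives determinant 1, and
   as o lies outside the last n columns, the corner block is untouched. *)
pose o : 'I_(n + (n + n) + n) := lshift n (lshift (n + n) (Ordinal n0)).
pose D x : 'rV[R[i]]_(n + (n + n) + n) := \row_k (if k == o then \det (U x) else 1).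
have detU2 x : \det (U x) * \det (U x) = 1 by rewrite -det_mulmx UU det1.
have detUJ x : \det (U x) * Num.conj (\det (U x)) = 1.
  by rewrite -sqr_normc_Cnorm expr2 -normcM detU2 normc1.
exists (fun x => U x *m diag_mx (D x)); split.
- apply: measurable_mxfunM => // i j.
  under eq_fun do rewrite !mxE; case: (i == j); last first.
    by under eq_fun do rewrite mulr0n; exact: measurable_cfun_cst.
  under eq_fun do rewrite mulr1n; case: (i == o); last exact: measurable_cfun_cst.
  exact: measurable_cfun_det.
- move=> x; split.
    apply: unitarymxM => //; apply/unitarymxP; rewrite tr_diag_mx map_diag_mx mulmx_diag.
    apply/matrixP => i j; rewrite !mxE; case: (i == o); first by rewrite detUJ.
    by rewrite rmorph1 mulr1.
  rewrite det_mulmx det_diag (bigD1 o)//= mxE eqxx big1 ?mulr1//.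
  by move=> k ko; rewrite mxE (negbTE ko).
- move=> x i j a b ai bj; rewrite mul_mx_diag mxE.
  have -> : a = lshift n (lshift (n + n) i) by apply: val_inj.
  have -> : b = rshift (n + (n + n)) j by apply: val_inj.
  by rewrite /U block_mxEur /V col_mxEu mxE eq_rlshift mulr1.
Qed.

End MeasurableDilation.

(** * Conclusion *)

Section LimitInL2.
Context {R : realType} {d : measure_display} {T : measurableType d}.
Context (P : probability T R) {N : nat}.
Context (G : (T -> 'M[R[i]]_N) -> Prop).
Hypothesis hG : unitary_group G.
Hypothesis mG : forall g, G g -> measurable_mxfun g.

Lemma sqr_normcE (z : R[i]) : normc z ^+ 2 = complex.Re z ^+ 2 + complex.Im z ^+ 2.
Proof. by case: z => a b; rewrite sqr_sqrtr// addr_ge0 ?sqr_ge0. Qed.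

Lemma measurable_sqr_mxnorm2 m n (F : T -> 'M[R[i]]_(m, n)) : measurable_mxfun F ->
  measurable_fun setT (fun x => mxnorm2 (F x) ^+ 2).
Proof.
move=> mF; under eq_fun do rewrite sqr_mxnorm2.
apply: measurable_sum => i; apply: measurable_sum => j.
under eq_fun do rewrite sqr_normcE.
by have [m1 m2] := mF i j; apply: measurable_funD; exact: measurable_funX.
Qed.

(** The squared norm is at most e^2 off A and C^2 on A, a set of mass at most e. *)
Lemma Lnorm2_le (F : T -> 'M[R[i]]_N) (A : set T) (e C eta : R) :
  measurable_mxfun F -> measurable A -> (P A <= e%:E)%E ->
  0 <= e -> 0 <= C -> 0 <= eta -> e ^+ 2 + C ^+ 2 * e <= eta ^+ 2 ->
  (forall x, nrm (F x) <= C) -> (forall x, ~ A x -> nrm (F x) <= e) ->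
  ('N[P]_2%:E [(fun x => (mxnorm2 (F x))%:E)] <= eta%:E)%E.
Proof.
move=> mF mA PA e0 C0 eta0 he FC Fe.
have -> : eta%:E = ((eta ^+ 2)%:E `^ 2^-1)%E.
  by rewrite poweR_EFin -powR_mulrn// -powRrM divff ?powRr1 ?pnatr_eq0.
rewrite unlock /Lnorm; apply: gt0_ler_poweR.
- by rewrite invr_ge0.
- by rewrite in_itv/= integral_ge0 ?leey// => x _; exact: poweR_ge0.
- by rewrite in_itv/= lee_fin sqr_ge0 leey.
under eq_integral => x _.
  rewrite abse_EFin poweR_EFin powR_mulrn// real_normK ?num_real//.
  over.
apply: (@le_trans _ _ (\int[P]_x ((e ^+ 2)%:E + (C ^+ 2)%:E * (\1_A x)%:E))%E).
  apply: ge0_le_integral => //.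
  - by move=> x _; rewrite lee_fin sqr_ge0.
  - exact/measurable_EFinP/measurable_sqr_mxnorm2.
  - apply/measurable_EFinP; apply: measurable_funD => //.
    by apply: measurable_funM => //; exact: measurable_indic.
  - move=> x _; rewrite -EFinM -EFinD lee_fin.
    have h c : nrm (F x) <= c -> 0 <= c -> mxnorm2 (F x) ^+ 2 <= c ^+ 2.
      move=> xc c0; rewrite ler_pXn2r ?nnegrE ?mxnorm2_ge0//.
      by apply: le_trans xc; exact: mxnorm2_le_nrm.
    have [xA|xA] := boolP (x \in A).
      rewrite indicE xA mulr1; apply: le_trans (h _ (FC x) C0) _.
      by rewrite lerDr sqr_ge0.
    rewrite indicE (negbTE xA) mulr0 addr0; apply: h => //; apply: Fe.
    by move: xA; rewrite notin_setE.
have mI : measurable_fun setT (fun x => (\1_A x)%:E : \bar R).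
  by apply/measurable_EFinP; exact: measurable_indic.
have I0 x : setT x -> (0 <= (\1_A x)%:E :> \bar R)%E by rewrite lee_fin.
have mCI : measurable_fun setT (fun x => ((C ^+ 2)%:E * (\1_A x)%:E)%E).
  by apply/measurable_EFinP; apply: measurable_funM => //; exact: measurable_indic.
have CI0 x : setT x -> (0 <= (C ^+ 2)%:E * (\1_A x)%:E)%E.
  by move=> _; rewrite -EFinM lee_fin mulr_ge0 ?sqr_ge0.
have e20 x : @setT T x -> (0 <= (e ^+ 2)%:E)%E by rewrite lee_fin sqr_ge0.
rewrite ge0_integralD// ge0_integralZl_EFin ?sqr_ge0//.
rewrite integral_indic// setIT (integral_cst P measurableT).
rewrite [X in (_ * X + _)%E](_ : _ = 1%E) ?mule1; last exact: (probability_setT P).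
apply: (@le_trans _ _ ((e ^+ 2)%:E + (C ^+ 2)%:E * e%:E)%E).
  by apply: leeD => //; apply: lee_pmul => //; rewrite ?lee_fin ?sqr_ge0.
by rewrite -EFinM -EFinD lee_fin.
Qed.

Lemma reach_Lnorm2 (Q : T -> 'M[R[i]]_N) : measurable_mxfun Q ->
  (forall x, Q x \is unitarymx) -> reach P G Q ->
  exists2 F : nat -> T -> 'M[R[i]]_N, forall l, G (F l) &
    ('N[P]_2%:E [(fun x => (mxnorm2 (F l x - Q x))%:E)])%E @[l --> \oo] --> 0%E.
Proof.
move=> mQ QU rQ; have [_ _ _ GU] := hG.
pose C : R := N%:R * N%:R + N%:R * N%:R.
have C0 : 0 <= C by rewrite addr_ge0 ?mulr_ge0.
have C1 : 0 < 1 + C ^+ 2 by rewrite ltr_pwDl ?sqr_ge0.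
have H l : exists g, G g /\
    ('N[P]_2%:E [(fun x => (mxnorm2 (g x - Q x))%:E)] <= (@harmonic R l)%:E)%E.
  have h0 : 0 < @harmonic R l by exact: harmonic_gt0.
  (* As e <= 1, the bound e^2 + C^2 e is at most e (1 + C^2), hence at most the square of the l-th
     harmonic term. *)
  pose e := Num.min 1 (@harmonic R l ^+ 2 / (1 + C ^+ 2)).
  have e0 : 0 < e by rewrite lt_min ltr01 divr_gt0// exprn_gt0.
  have [g Gg [A [mA PA gA]]] := rQ _ e0; exists g; split => //.
  apply: (Lnorm2_le (A := A) (e := e) (C := C)) => //.
  - by apply: measurable_mxfunB => //; exact: mG.
  - exact: ltW.
  - exact: ltW.
  - have e1 : e <= 1 by rewrite ge_min lexx.
    apply: (@le_trans _ _ (e * (1 + C ^+ 2))).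
      by rewrite mulrDr mulr1 lerD// ?[e * _]mulrC// expr2 ler_piMl// ltW.
    by rewrite -ler_pdivlMr// ge_min lexx orbT.
  - move=> x; apply: le_trans (nrmB _ _) _; rewrite lerD// nrm_unitarymx//.
    exact: GU.
have /choice[F FP] := H.
exists F; first by move=> l; have [] := FP l.
apply: (@squeeze_cvge _ _ _ _ (fun=> 0%E) _ (fun l => (@harmonic R l)%:E)).
- by apply: nearW => l; rewrite Lnorm_ge0 /=; have [] := FP l.
- exact: cvg_cst.
- by apply/fine_cvgP; split; [exact: nearW|exact: cvg_harmonic].
Qed.

End LimitInL2.

Section TorusNull.
Context {R : realType}.

(** A null set in one variable times the circle is null on the torus. A measurable A is produced
    because it will serve to truncate B1(z) B2(w). *)
Lemma torus_good_set (p q : circle R -> Prop) :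
  {ae circle_prob R, forall z, p z} -> {ae circle_prob R, forall z, q z} ->
  exists2 A : set (circle R * circle R), measurable A &
    (forall x, A x -> p x.1 /\ q x.2) /\ torus_prob R (~` A) = 0%E.
Proof.
move=> [Z1 [mZ1 PZ1 Z1p]] [Z2 [mZ2 PZ2 Z2q]].
have p1 z : ~ Z1 z -> p z.
  by move=> nZ; apply: contrapT => npz; apply: nZ; exact: Z1p.
have q2 z : ~ Z2 z -> q z.
  by move=> nZ; apply: contrapT => nqz; apply: nZ; exact: Z2q.
exists (~` (Z1 `*` setT `|` setT `*` Z2)).
  by apply: measurableC; apply: measurableU; exact: measurableX.
split.
  move=> x /= nx; split; [apply: p1|apply: q2] => h; apply: nx; [left|right] => //.
rewrite setCK; apply: null_set_setU.
- exact: measurableX.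
- exact: measurableX.
- by rewrite /torus_prob /= product_measure1E// [X in (X * _)%E]PZ1 mul0e.
- by rewrite /torus_prob /= product_measure1E// [X in (_ * X)%E]PZ2 mule0.
Qed.

End TorusNull.

Theorem corollaryA3 (R : realType) (sq : circle R -> R[i])
  (sq_measurable : measurable_cfun sq)
  (sqP : forall z : circle R, sq z ^+ 2 = z)
  (s n : nat) (s_ge1 : (1 <= s)%N) (n_def : n = (2 ^ s.-1)%N)
  (B1 B2 : circle R -> 'M[R[i]]_n) :
  classS B1 -> classS B2 ->
  attainable sq s.+1 (fun zw : circle R * circle R => B1 zw.1 *m B2 zw.2).
Proof.
move=> [mB1 B1lt _] [mB2 B2lt _].
have n_gt0 : (0 < n)%N by rewrite n_def expn_gt0.
have sE : s = s.-1.+1 by rewrite prednK.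
have NE : (n + (n + n) + n = 2 ^ s.+1)%N.
  by rewrite n_def [in RHS]sE !expnS !mul2n -!addnn !addnA.
have kN : (n <= 2 ^ s.+1)%N by rewrite -NE leq_addl.
have [A mA [AB PA]] := torus_good_set B1lt B2lt.
(* Setting the product to 0 off A makes it a strict contraction at every point, as the dilation
   demands, and changes it on a null set only. *)
pose B (x : circle R * circle R) := (\1_A x)%:C *: (B1 x.1 *m B2 x.2).
have mB : measurable_mxfun B.
  apply: measurable_mxfunZ; first exact/measurable_cfun_real/measurable_indic.
  apply: measurable_mxfunM => i j.
    have [m1 m2] := mB1 i j.
    by split; [exact: (measurableT_comp m1 measurable_fst)
              |exact: (measurableT_comp m2 measurable_fst)].
  have [m1 m2] := mB2 i j.
  by split; [exact: (measurableT_comp m1 measurable_snd)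
            |exact: (measurableT_comp m2 measurable_snd)].
have sB x : strict_contraction (B x).
  rewrite /B indicE; have [xA|xA] := boolP (x \in A); last first.
    by rewrite scale0r; exact: strict_contraction0.
  have [h1 h2] := AB x (set_mem xA); rewrite scale1r.
  by apply: strict_contractionM; exact: opnorm_lt1_strict.
have [Q [mQ QSU QB]] := measurable_dilation NE n_gt0 mB sB.
have N_gt0 : (0 < 2 ^ s.+1)%N by rewrite expn_gt0.
have hG := protocol_group sq s.+1.
have rQ : reach (torus_prob R) (@protocol R sq s.+1) Q.
  by apply: reach_SUmx => // E mE; exact: torus_steerable_indic.
have mG (g : circle R * circle R -> 'M[R[i]]_(2 ^ s.+1)) : protocol sq g -> measurable_mxfun g.
  by case.
have QU x : Q x \is unitarymx by case: (QSU x).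
have [F GF FQ] := reach_Lnorm2 hG mG mQ QU rQ.
split => //.
- by exists s.-1.
- by rewrite n_def leq_exp2l// leq_pred.
exists kN, Q; split.
  by right; exists F; split => [l|//]; case: (GF l).
exists (~` A); split => //; first exact: measurableC.
apply: subsetC => x Ax /=; apply/matrixP => i j.
rewrite /topright [RHS]mxE [RHS]mxE castmxE (QB x i j); last 2 first.
- by [].
(* The last n columns start at 2 ^ s.+1 - n = n + (n + n). *)
- by rewrite /= -NE addnK.
by rewrite /B indicE mem_set// scale1r.
Qed.
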